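(* Let $\mathcal{Z}=\mathcal{X}\times\mathcal{Y}\subseteq\mathbb{R}^d$ be non-empty, closed and convex, with $\|z_1-z_2\|\le D$ for all $z_1,z_2\in\mathcal{Z}$, where $D>0$. Let $0<\delta\le L$ and let $f_1,\dots,f_n:\mathbb{R}^{d_x}\times\mathbb{R}^{d_y}\to\mathbb{R}$ be twice differentiable, $L$-smooth, convex-concave, with $\delta$-second-order similarity. Let $\varepsilon>0$ and run SVOGS (with $K\ge 1$ iterations) with $$b=\lceil\sqrt{n}\,\rceil,\quad \gamma=p=\frac{1}{\sqrt{n}+8},\quad \eta=\min\Big\{\frac{\sqrt{\gamma b}}{4\delta},\frac{1}{32\delta}\Big\},\quad \alpha=1,$$ $$\varepsilon_k=\min\big\{\zeta,\ \hat c^{-1}\min\{\|\hat u^k-z^k\|,\|\hat u^k-z^k\|^2\}\big\},$$ where $$\zeta=\min\left\{\frac{\eta^2\varepsilon^2}{16\big(9\eta LD+3\eta\max_{i\in[n]}\|F_i(z^0)\|+D\big)^2},\ \frac{\eta\varepsilon}{4(12\eta^2\delta^2+1)}\right\},\qquad \hat c=100+2048\eta^2\delta^2+64\sqrt{2\eta\Phi^0}.$$ Then $$\mathbb{E}\left[\max_{z\in\mathcal{Z}}\frac1K\sum_{k=0}^{K-1}\langle F(u^k),u^k-z\rangle\right]\le\frac{10D^2}{\eta K}+\frac{\varepsilon}{2}.$$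
   Context: Problem: $\min_{x\in\mathcal{X}}\max_{y\in\mathcal{Y}} f(x,y):=\frac1n\sum_{i=1}^n f_i(x,y)$, with $\mathcal{X}\subseteq\mathbb{R}^{d_x}$, $\mathcal{Y}\subseteq\mathbb{R}^{d_y}$, $d=d_x+d_y$, $z=(x,y)$, $[n]=\{1,\dots,n\}$. Write $F_i(z)=[\nabla_x f_i(x,y);-\nabla_y f_i(x,y)]$ and $F=\frac1n\sum_{i=1}^n F_i$. ''$L$-smooth'': $\|F_i(z_1)-F_i(z_2)\|\le L\|z_1-z_2\|$ for all $i$ and $z_1,z_2\in\mathbb{R}^d$. ''Convex-concave'': convex in $x$ for fixed $y$ and concave in $y$ for fixed $x$. ''$\delta$-second-order similarity'': $\|\nabla^2 f_i(x,y)-\nabla^2 f(x,y)\|\le\delta$ for all $i,x,y$ (spectral norm). Algorithm SVOGS. Input: $z^0\in\mathcal{Z}$, step size $\eta>0$, accuracies $\varepsilon_k$, number of iterations $K$, mini-batch size $b$, probability $p\in(0,1]$, weights $\alpha,\gamma$. Initialize $w^{-1}=z^{-1}=w^0=z^0$. For $k=0,\dots,K-1$: (1) $\bar z^k=(1-\gamma)z^k+\gamma w^k$. (2) Sample $\mathcal{S}^k=\{j_1^k,\dots,j_b^k\}$ uniformly and independently from $[n]$. (3) $\delta^k=F(w^{k-1})-F_1(w^{k-1})+\frac1b\sum_{j\in\mathcal{S}^k}\big(F_j(z^k)-F_1(z^k)-F_j(w^{k-1})+F_1(w^{k-1})\big)+\frac{\alpha}{b}\sum_{j\in\mathcal{S}^k}\big(F_j(z^k)-F_1(z^k)-F_j(z^{k-1})+F_1(z^{k-1})\big)$.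 (4) $v^k=(v^k_x,v^k_y)=\bar z^k-\eta\delta^k$. (5) Find $u^k\in\mathbb{R}^d$ with $\|u^k-\hat u^k\|^2\le\varepsilon_k$, where $\hat u^k$ is the solution of $\min_{\hat x\in\mathcal{X}}\max_{\hat y\in\mathcal{Y}}\{f_1(\hat x,\hat y)+\frac1{2\eta}\|\hat x-v^k_x\|^2-\frac1{2\eta}\|\hat y-v^k_y\|^2\}$. (6) $z^{k+1}=u^k$. (7) $w^{k+1}=z^{k+1}$ with probability $p$, and $w^{k+1}=w^k$ with probability $1-p$. Expectation is over the random sets $\mathcal{S}^k$ and the random updates in (7). $\Phi^0$ is the initial value of the Lyapunov function (with $\mu=0$): since $w^{-1}=z^{-1}=w^0=z^0$, $\Phi^0=\frac1\eta\|z^0-z^*\|^2+\frac{\gamma}{p\eta}\|w^0-z^*\|^2$, where $z^*\in\mathcal{Z}$ is a solution (saddle point) of the problem. *)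

(* Defs.v *)
From mathcomp Require Export all_boot all_order all_algebra.
From mathcomp Require Export all_classical all_reals all_analysis.
Import Order.TTheory GRing.Theory Num.Theory.
Export numFieldNormedType.Exports.

Set Implicit Arguments.
Unset Strict Implicit.
Unset Printing Implicit Defensive.

Local Open Scope classical_set_scope.
Local Open Scope ring_scope.

Section euclidean.
Context {R : realType}.

Definition dot m (u v : 'rV[R]_m) : R := (u *m v^T) 0 0.

(* The norm `|u| that the library puts on 'rV[R]_m is the sup norm. *)
Definition enorm m (u : 'rV[R]_m) : R := Num.sqrt (dot u u).

Definition spectral_norm m (A : 'M[R]_m) : R :=
  sup [set enorm (v *m A) | v in [set v | enorm v <= 1]].

Definition grad m (g : 'rV[R]_m -> R) (z : 'rV[R]_m) : 'rV[R]_m :=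
  \row_j 'D_(delta_mx 0 j) (g : 'rV[R]_m -> R^o) z.

Definition hessian m (g : 'rV[R]_m -> R) (z : 'rV[R]_m) : 'M[R]_m :=
  'J (grad g) z.

Definition twice_differentiable m (g : 'rV[R]_m -> R) : Prop :=
  (forall z, differentiable (g : 'rV[R]_m -> R^o) z) /\
  (forall z, differentiable (grad g) z).

End euclidean.

(* A point z = (x, y) is the row vector row_mx x y, so that x = lsubmx z and
   y = rsubmx z. *)
Section minimax.
Context {R : realType} {dx dy : nat}.
Local Notation V := 'rV[R]_(dx + dy).

Definition prodset (X : set 'rV[R]_dx) (Y : set 'rV[R]_dy) : set V :=
  [set z | X (lsubmx z) /\ Y (rsubmx z)].

Definition convex_concave (g : V -> R) : Prop :=
  (forall y : 'rV[R]_dy, convex_function setT (fun x => g (row_mx x y))) /\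
  (forall x : 'rV[R]_dx, convex_function setT (fun y => - g (row_mx x y))).

Definition saddle_point (X : set 'rV[R]_dx) (Y : set 'rV[R]_dy) (g : V -> R)
    (z : V) : Prop :=
  prodset X Y z /\
  forall x y, X x -> Y y ->
    g (row_mx (lsubmx z) y) <= g z /\ g z <= g (row_mx x (rsubmx z)).

Definition gdfield (g : V -> R) (z : V) : V :=
  row_mx (lsubmx (grad g z)) (- rsubmx (grad g z)).

Section finite_sum.
Context {n : nat}.
Variable f : 'I_n -> V -> R.

Definition favg (z : V) : R := n%:R^-1 * \sum_(i < n) f i z.

Definition Fc (i : 'I_n) (z : V) : V := gdfield (f i) z.

Definition Favg (z : V) : V := n%:R^-1 *: \sum_(i < n) Fc i z.

Definition smooth (L : R) : Prop :=
  forall i z1 z2, enorm (Fc i z1 - Fc i z2) <= L * enorm (z1 - z2).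

Definition second_order_similarity (delta : R) : Prop :=
  forall i z, spectral_norm (hessian (f i) z - hessian favg z) <= delta.

End finite_sum.
End minimax.

(* All the randomness of K iterations: (om k).1 is the mini-batch
   (j_1^k, ..., j_b^k), drawn with replacement, and (om k).2 is true when w is
   updated at iteration k. *)
Definition outcome (n b K : nat) := {ffun 'I_K -> {ffun 'I_b -> 'I_n} * bool}.

Section expectation.
Context {R : realType} {n b K : nat}.

Definition outcome_prob (p : R) (om : outcome n b K) : R :=
  \prod_(k < K) ((\prod_(l < b) n%:R^-1) * (if (om k).2 then p else 1 - p)).

Definition expect (p : R) (Q : outcome n b K -> R) : R :=
  \sum_(om : outcome n b K) outcome_prob p om * Q om.

End expectation.

Section svogs.
Context {R : realType} {dx dy n b K : nat}.
Local Notation V := 'rV[R]_(dx + dy).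
Local Notation Omega := (outcome n b K).
Variables (X : set 'rV[R]_dx) (Y : set 'rV[R]_dy) (f : 'I_n -> V -> R).
Variables (i1 : 'I_n) (eta alpha gamma : R).

Definition svogs_delta (S : 'I_b -> 'I_n) (z zprev wprev : V) : V :=
  Favg f wprev - Fc f i1 wprev
  + b%:R^-1 *: \sum_(l < b) (Fc f (S l) z - Fc f i1 z
                             - Fc f (S l) wprev + Fc f i1 wprev)
  + (alpha / b%:R) *: \sum_(l < b) (Fc f (S l) z - Fc f i1 z
                                    - Fc f (S l) zprev + Fc f i1 zprev).

Definition svogs_v (S : 'I_b -> 'I_n) (z w zprev wprev : V) : V :=
  ((1 - gamma) *: z + gamma *: w) - eta *: svogs_delta S z zprev wprev.

Definition svogs_objective (v z : V) : R :=
  f i1 z + (2 * eta)^-1 * enorm (lsubmx z - lsubmx v) ^+ 2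
         - (2 * eta)^-1 * enorm (rsubmx z - rsubmx v) ^+ 2.

(* The initialization z^{-1} = z^0 and w^{-1} = w^0 is built into the truncated
   predecessor: 0.-1 = 0.  The inexact solver may return any admissible point,
   chosen as a function of what has been drawn so far; svogs_adapted says that
   it cannot see the coin of the current iteration nor later draws. *)
Record svogs (z0 : V) (eps : 'I_K -> Omega -> R) (z w : nat -> Omega -> V)
    (u uhat : 'I_K -> Omega -> V) : Prop := Svogs {
  svogs_z0 : forall om, z 0%N om = z0;
  svogs_w0 : forall om, w 0%N om = z0;
  svogs_exact : forall (k : 'I_K) (om : Omega),
    saddle_point X Y
      (svogs_objective
        (svogs_v (om k).1 (z k om) (w k om) (z k.-1 om) (w k.-1 om)))
      (uhat k om);
  svogs_inexact : forall (k : 'I_K) (om : Omega), enorm (u k om - uhat k om) ^+ 2 <= eps k om;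
  svogs_adapted : forall (k : 'I_K) (om om' : Omega),
    (forall j : 'I_K, (j < k)%N -> om j = om' j) -> (om k).1 = (om' k).1 ->
    u k om = u k om';
  svogs_z : forall (k : 'I_K) (om : Omega), z k.+1 om = u k om;
  svogs_w : forall (k : 'I_K) (om : Omega),
    w k.+1 om = if (om k).2 then z k.+1 om else w k om
}.

End svogs.

(* Main.v *)
(** The gap is bounded along each path.  The first-order conditions of the
    regularised saddle problem defining [uhat] give a one-step inequality with
    the telescoping potential
      [eta <G z_k - G z_(k-1), z_k - zz> - (1 - gamma)/2 |z_k - zz|^2
       - |w_k - zz|^2 / 2],   [G = F - F_1],
    and with the negative terms [|uhat - z_k|^2] and [gamma |uhat - w_k|^2].
    Since [chat >= 100], the solver error is at most [|uhat - z_k| / 10], so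
    these terms absorb its quadratic contributions; the linear ones are paid by
    [zeta].

    What remains couples the random increments to the arbitrary point [zz]
    only linearly.  With [M] a sum of centred increments,
    [<M, zz - z0> <= 2 D^2 + |M|^2 / 8] frees [M] of [zz] before the maximum is
    taken, and [E |M|^2] is the sum of the second moments of the increments
    by orthogonality.  The minibatch variance is governed by the [delta]-Lipschitz
    maps [F_i - F], hence is at most
    [2 delta^2 / b (|z_k - w_(k-1)|^2 + |z_k - z_(k-1)|^2)], again absorbed. *)

From HB Require Import structures.
Require Import Defs.
From mathcomp Require Import ring lra.
Import Order.TTheory GRing.Theory Num.Theory.
Local Open Scope classical_set_scope.
Local Open Scope ring_scope.

Set Implicit Arguments.
Unset Strict Implicit.
Unset Printing Implicit Defensive.

(** * The Euclidean norm *)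

Section euclidean_space.
Context {R : realType} {m : nat}.
Implicit Types (u v w : 'rV[R]_m) (c : R).

Lemma dotE u v : dot u v = \sum_j u 0 j * v 0 j.
Proof. by rewrite /dot !mxE; apply: eq_bigr => j _; rewrite mxE. Qed.

Lemma dotC u v : dot u v = dot v u.
Proof. by rewrite !dotE; apply: eq_bigr => j _; rewrite mulrC. Qed.

Lemma dotDl u v w : dot (u + v) w = dot u w + dot v w.
Proof. by rewrite /dot mulmxDl mxE. Qed.

Lemma dotDr u v w : dot w (u + v) = dot w u + dot w v.
Proof. by rewrite dotC dotDl !(dotC w). Qed.

Lemma dotNl u w : dot (- u) w = - dot u w.
Proof. by rewrite /dot mulNmx mxE. Qed.

Lemma dotNr u w : dot w (- u) = - dot w u.
Proof. by rewrite dotC dotNl dotC. Qed.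

Lemma dotBl u v w : dot (u - v) w = dot u w - dot v w.
Proof. by rewrite dotDl dotNl. Qed.

Lemma dotBr u v w : dot w (u - v) = dot w u - dot w v.
Proof. by rewrite dotDr dotNr. Qed.

Lemma dotZl c u w : dot (c *: u) w = c * dot u w.
Proof. by rewrite /dot -scalemxAl mxE. Qed.

Lemma dotZr c u w : dot w (c *: u) = c * dot w u.
Proof. by rewrite dotC dotZl dotC. Qed.

Lemma dot0l w : dot 0 w = 0.
Proof. by rewrite /dot mul0mx mxE. Qed.

Lemma dot0r w : dot w 0 = 0.
Proof. by rewrite dotC dot0l. Qed.

Lemma dot_suml (I : Type) (r : seq I) (P : pred I) (F : I -> 'rV[R]_m) w :
  dot (\sum_(i <- r | P i) F i) w = \sum_(i <- r | P i) dot (F i) w.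
Proof. by rewrite (big_morph (fun u => dot u w) (fun u v => dotDl u v w) (dot0l w)). Qed.

Lemma dot_sumr (I : Type) (r : seq I) (P : pred I) (F : I -> 'rV[R]_m) w :
  dot w (\sum_(i <- r | P i) F i) = \sum_(i <- r | P i) dot w (F i).
Proof. by rewrite dotC dot_suml; apply: eq_bigr => i _; rewrite dotC. Qed.

Lemma dot_ge0 u : 0 <= dot u u.
Proof. by rewrite dotE; apply: sumr_ge0 => j _; rewrite -expr2 sqr_ge0. Qed.

Lemma enorm_ge0 u : 0 <= enorm u.
Proof. exact: sqrtr_ge0. Qed.

Lemma sqr_enorm u : enorm u ^+ 2 = dot u u.
Proof. by rewrite sqr_sqrtr ?dot_ge0. Qed.

Lemma sqr_enormD u v :
  enorm (u + v) ^+ 2 = enorm u ^+ 2 + 2 * dot u v + enorm v ^+ 2.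
Proof. by rewrite !sqr_enorm !(dotDl, dotDr) (dotC v u); ring. Qed.

Lemma enorm_le u c : 0 <= c -> (enorm u <= c) = (dot u u <= c ^+ 2).
Proof. by move=> c0; rewrite -sqr_enorm ler_sqr ?nnegrE ?enorm_ge0. Qed.

Lemma enormN u : enorm (- u) = enorm u.
Proof. by rewrite /enorm dotNl dotNr opprK. Qed.

Lemma enormBC u v : enorm (u - v) = enorm (v - u).
Proof. by rewrite -enormN opprB. Qed.

Lemma enormZ c u : enorm (c *: u) = `|c| * enorm u.
Proof. by rewrite /enorm dotZl dotZr mulrA -expr2 sqrtrM ?sqr_ge0// sqrtr_sqr. Qed.

Lemma enorm0 : enorm (0 : 'rV[R]_m) = 0.
Proof. by rewrite /enorm dot0l sqrtr0. Qed.

Lemma enorm_eq0 u : (enorm u == 0) = (u == 0).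
Proof.
apply/eqP/eqP => [u0|->]; last exact: enorm0.
have : dot u u == 0 by rewrite -sqr_enorm u0 expr0n.
rewrite dotE psumr_eq0 => [/allP uj0|j _]; last by rewrite -expr2 sqr_ge0.
apply/rowP => j; rewrite mxE; apply/eqP.
by have := uj0 j (mem_index_enum j); rewrite /= mulf_eq0 orbb.
Qed.

(** Cauchy-Schwarz: expand the squared norm of [enorm v *: u - enorm u *: v] and divide by
    [2 * enorm u * enorm v]. *)
Lemma dot_le u v : dot u v <= enorm u * enorm v.
Proof.
have [->|u0] := eqVneq u 0; first by rewrite dot0l enorm0 mul0r.
have [->|v0] := eqVneq v 0; first by rewrite dot0r enorm0 mulr0.
have pu : 0 < enorm u by rewrite lt_neqAle enorm_ge0 eq_sym enorm_eq0 u0.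
have pv : 0 < enorm v by rewrite lt_neqAle enorm_ge0 eq_sym enorm_eq0 v0.
have := dot_ge0 (enorm v *: u - enorm u *: v).
rewrite !(dotBl, dotBr, dotZl, dotZr) -!sqr_enorm (dotC v u) => H.
have : 0 <= 2 * (enorm u * enorm v) * (enorm u * enorm v - dot u v) by lra.
by rewrite pmulr_rge0 ?subr_ge0// !mulr_gt0.
Qed.

Lemma dot_le_of u v a b : enorm u <= a -> enorm v <= b -> dot u v <= a * b.
Proof. by move=> ua vb; rewrite (le_trans (dot_le u v))// ler_pM ?enorm_ge0. Qed.

Lemma enormD u v : enorm (u + v) <= enorm u + enorm v.
Proof.
rewrite enorm_le ?addr_ge0 ?enorm_ge0// -sqr_enorm sqr_enormD sqrrD.
have := dot_le u v; lra.
Qed.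

Lemma enormB_trans v u w : enorm (u - w) <= enorm (u - v) + enorm (v - w).
Proof. by rewrite (le_trans _ (enormD _ _))// addrA subrK. Qed.

Lemma enorm_sum (I : Type) (r : seq I) (P : pred I) (F : I -> 'rV[R]_m) :
  enorm (\sum_(i <- r | P i) F i) <= \sum_(i <- r | P i) enorm (F i).
Proof.
elim/big_ind2 : _ => [|u a v b ua vb|//]; first by rewrite enorm0.
by rewrite (le_trans (enormD _ _))// lerD.
Qed.

Lemma dot_young c u v : 0 < c ->
  dot u v <= c * enorm u ^+ 2 + (4 * c)^-1 * enorm v ^+ 2.
Proof.
move=> c0; have := dot_ge0 ((2 * c) *: u - v).
rewrite !(dotBl, dotBr, dotZl, dotZr) -!sqr_enorm (dotC v u) => H.
have c4 : 0 < 4 * c by rewrite mulr_gt0.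
have e : c * enorm u ^+ 2 + (4 * c)^-1 * enorm v ^+ 2
   = (4 * c)^-1 * ((2 * c) ^+ 2 * enorm u ^+ 2 + enorm v ^+ 2).
  by field; rewrite gt_eqF.
by rewrite e ler_pdivlMl//; lra.
Qed.

Lemma enorm_mulmx_le (A : 'M[R]_m) v : enorm (v *m A) <= spectral_norm A * enorm v.
Proof.
have [->|v0] := eqVneq v 0; first by rewrite mul0mx enorm0 mulr0.
have pv : 0 < enorm v by rewrite lt_neqAle enorm_ge0 eq_sym enorm_eq0 v0.
rewrite -ler_pdivrMr//; apply: ub_le_sup; last first.
  exists ((enorm v)^-1 *: v) => /=.
    by rewrite enormZ ger0_norm ?invr_ge0 ?enorm_ge0// mulVf ?gt_eqF.
  by rewrite -scalemxAl enormZ ger0_norm ?invr_ge0 ?enorm_ge0// mulrC.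
(* The supremum is usable only once its set is bounded. Coordinates of a vector of the unit ball are
   at most 1 in absolute value, so the row norms add up to a bound. *)
exists (\sum_i enorm (row i A)) => _ /= [w w1 <-].
rewrite mulmx_sum_row (le_trans (enorm_sum _ _ _))// ler_sum// => i _.
rewrite enormZ ler_piMl ?enorm_ge0// -(@ler_sqr _ _ 1) ?nnegrE// expr1n.
rewrite real_normK ?num_real// (le_trans _ (_ : dot w w <= 1))//; last first.
  by rewrite -(expr1n _ 2) -enorm_le.
rewrite dotE (bigD1 i)//= expr2 lerDl sumr_ge0// => j _.
by rewrite -expr2 sqr_ge0.
Qed.

End euclidean_space.

(** * Gradients and Jacobians *)

Section calculus.
Context {R : realType} {m : nat}.
Local Notation V := 'rV[R]_m.

Lemma derive_grad (g : V -> R) (z h : V) :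
  differentiable (g : V -> R^o) z -> 'D_h (g : V -> R^o) z = dot (grad g z) h.
Proof.
move=> dg; rewrite deriveE// [in LHS](row_sum_delta h) linear_sum dotE.
by apply: eq_bigr => j _; rewrite linearZ mxE deriveE// [RHS]mulrC.
Qed.

Lemma dot_continuous (a : V) : continuous (fun v : V => dot v a : R^o).
Proof.
rewrite (_ : (fun v => _) = fun v : V => \sum_j v 0 j * a 0 j : R^o).
  move=> v; apply: (@cvg_big R^o _ _ _ _ _ _ (nbhs v)) => [|j _].
    exact: add_continuous.
  by apply: (@cvgM R); [exact: coord_continuous|exact: cvg_cst].
by apply/funext => v; rewrite dotE.
Qed.

Lemma row_jacobian (H : V -> V) (z : V) k :
  differentiable H z -> row k ('J H z) = 'D_(delta_mx 0 k) H z.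
Proof. by move=> dH; rewrite (deriveEjacobian _ dH) -rowE. Qed.

Lemma jacobianB (F G : V -> V) (z : V) :
  differentiable F z -> differentiable G z -> 'J (F - G) z = 'J F z - 'J G z.
Proof.
move=> dF dG; apply/row_matrixP => k.
have rowB (A B : 'M[R]_m) : row k (A - B) = row k A - row k B.
  by apply/rowP => j; rewrite !mxE.
have eFG := row_jacobian k (differentiableB dF dG).
have eF := row_jacobian k dF; have eG := row_jacobian k dG.
have dB : 'D_(delta_mx 0 k) (F - G) z =
    'D_(delta_mx 0 k) F z - 'D_(delta_mx 0 k) G z.
  by apply: deriveB; exact: diff_derivable.
apply: (etrans eFG); apply: (etrans dB).
apply: etrans (esym (rowB _ _)).
by congr (_ - _); apply: esym.
Qed.

(** The scalar mean value theorem is applied to [phi], the pairing of [H] along the segment with the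
    fixed increment [a]. It gives [|a|^2 = <h J, a> <= c |h| |a|], and [|a|] cancels. *)
Lemma hessian_lipschitz (H : V -> V) (c : R) :
  (forall z, differentiable H z) ->
  (forall z, spectral_norm ('J H z) <= c) ->
  forall z1 z2, enorm (H z1 - H z2) <= c * enorm (z1 - z2).
Proof.
move=> dH Jc z1 z2; set a := H z1 - H z2; set h := z1 - z2.
pose phi (t : R) : R^o := dot (H (z2 + t *: h)) a.
pose dphi (t : R) : R^o := dot ('D_h H (z2 + t *: h)) a.
have dphiP (t : R) : is_derive t 1 phi (dphi t).
  have : (fun s : R => phi (s *: 1 + t)) = (fun s : R => phi (s + t)).
    by apply/funext => s; rewrite [s%:A]mulr1.
  have dHt : derivable H (z2 + t *: h) h by exact: diff_derivable.
  have cphi : s^-1 *: ((phi \o shift t) (s *: 1) - phi t)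
      @[s --> 0^'] --> dphi t.
    rewrite [X in X @ _ --> _](_ : _ = (fun v => dot v a) \o
      (fun s => s^-1 *: ((H \o shift (z2 + t *: h)) (s *: h) - H (z2 + t *: h)))).
      apply: continuous_cvg => //; first exact: dot_continuous.
    apply/funext => s /=; rewrite dotZl dotBl /phi [s%:A]mulr1 scalerDl.
    by rewrite addrCA.
  by split; [apply/cvg_ex; exists (dphi t)|exact: cvg_lim cphi].
have [|x _] := @MVT R phi dphi 0 1 ltr01 (fun t _ => dphiP t).
  by apply: derivable_within_continuous => t _; exact: ex_derive.
rewrite subr0 mulr1 /phi scale1r scale0r addr0 -dotBl.
rewrite [z2 + h]addrC subrK -/a => e.
(* For [a = 0], [c * enorm h] is nonnegative because it dominates the norm of [h *m 'J H 0]. *)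
have [->|a0] := eqVneq a 0.
  rewrite enorm0 (le_trans (enorm_ge0 (h *m 'J H 0)))//.
  by rewrite (le_trans (enorm_mulmx_le _ _))// ler_wpM2r ?enorm_ge0.
have pa : 0 < enorm a by rewrite lt_neqAle enorm_ge0 eq_sym enorm_eq0 a0.
rewrite -(ler_pM2r pa) -expr2 sqr_enorm e /dphi deriveEjacobian//.
rewrite (le_trans (dot_le _ _))// ler_pM2r//.
by rewrite (le_trans (enorm_mulmx_le _ _))// ler_wpM2r ?enorm_ge0.
Qed.

(** Divide by [t] and let [t] tend to 0 from the right: [b * t] disappears. The terms
    [a * t + b * t ^+ 2] are the exact increment of a quadratic penalty, so only [g] is
    differentiated. *)
Lemma first_order_ge0 (g : V -> R) (z h : V) (a b : R) :
  differentiable (g : V -> R^o) z ->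
  (forall t, 0 < t -> t < 1 -> 0 <= g (z + t *: h) - g z + a * t + b * t ^+ 2) ->
  0 <= dot (grad g z) h + a.
Proof.
move=> dg H; rewrite -derive_grad//.
have dgz : derivable (g : V -> R^o) z h by exact: diff_derivable.
have q : (t^-1 *: ((g \o shift z) (t *: h) - g z) + (a + b * t) : R^o)
    @[t --> (0 : R)^'+] --> ('D_h (g : V -> R^o) z + (a + b * 0) : R^o).
  apply: cvgD; first by apply: cvg_dnbhs_at_right; exact: dgz.
  apply: cvgD; first exact: cvg_cst.
  apply: cvgM; first exact: cvg_cst.
  by apply: cvg_at_right_filter; exact: cvg_id.
rewrite mulr0 addr0 in q; rewrite -(cvg_lim _ q)//.
apply: limr_ge; first by apply/cvg_ex; eexists; exact: q.
near=> t.
have t0 : 0 < t by near: t; exact: nbhs_right_gt.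
have t1 : t < 1 by near: t; exact: nbhs_right_lt.
rewrite /= [t *: h + z]addrC -[_ *: _]/(t^-1 * (g (z + t *: h) - g z)).
set X := g _ - g z; have -> : t^-1 * X + (a + b * t) =
    t^-1 * (X + a * t + b * t ^+ 2) by field; rewrite gt_eqF.
by rewrite mulr_ge0 ?H// invr_ge0 ltW.
Unshelve. all: by end_near. Qed.
End calculus.

(** * The gradient field *)

Section gradient_field.
Context {R : realType} {dx dy : nat}.
Local Notation V := 'rV[R]_(dx + dy).

Lemma dot_submx (u v : V) :
  dot u v = dot (lsubmx u) (lsubmx v) + dot (rsubmx u) (rsubmx v).
Proof.
by rewrite /dot -{1}(hsubmxK u) -{1}(hsubmxK v) tr_row_mx mul_row_col mxE.
Qed.

Lemma lsubmxB (u v : V) : lsubmx (u - v) = lsubmx u - lsubmx v.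
Proof. by apply/rowP => j; rewrite !mxE. Qed.

Lemma rsubmxB (u v : V) : rsubmx (u - v) = rsubmx u - rsubmx v.
Proof. by apply/rowP => j; rewrite !mxE. Qed.

(** [gdfield g] is [flip] of the gradient; since [flip] is a linear isometry, Lipschitz bounds pass
    from gradients to gradient fields. *)
Definition flip (v : V) : V := row_mx (lsubmx v) (- rsubmx v).

Lemma flip_is_linear : linear flip.
Proof.
move=> a u v; rewrite /flip scale_row_mx add_row_mx.
by congr row_mx; apply/rowP => j; rewrite !mxE ?opprD ?mulrN.
Qed.

HB.instance Definition _ := GRing.isLinear.Build R V V _ flip flip_is_linear.

Lemma enorm_flip v : enorm (flip v) = enorm v.
Proof.
congr (Num.sqrt _); rewrite !dot_submx row_mxKl row_mxKr.
by rewrite dotNl dotNr opprK.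
Qed.

Lemma gdfieldE (g : V -> R) z : gdfield g z = flip (grad g z).
Proof. by []. Qed.

Lemma dot_gdfield (g : V -> R) z v :
  dot (gdfield g z) v = dot (grad g z) (row_mx (lsubmx v) 0)
                      + dot (- grad g z) (row_mx 0 (rsubmx v)).
Proof.
rewrite !dot_submx !row_mxKl !row_mxKr !dot0r addr0 add0r.
by congr (_ + dot _ _); apply/rowP => j; rewrite !mxE.
Qed.

Context {n : nat}.
Variable f : 'I_n -> V -> R.

Section second_order.
Hypothesis f_diff2 : forall i, twice_differentiable (f i).

Lemma favgE : favg f = n%:R^-1 *: \sum_(i < n) (f i : V -> R^o).
Proof. by apply/funext => z; rewrite /favg /= fct_sumE. Qed.

Lemma grad_favg : grad (favg f) = n%:R^-1 *: \sum_(i < n) grad (f i).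
Proof.
have dv i z v : derivable (f i : V -> R^o) z v.
  exact/diff_derivable/(f_diff2 i).1.
apply/funext => z; apply/rowP => j.
rewrite [in RHS]/= fct_sumE !mxE summxE favgE deriveZ; last exact: derivable_sum.
by rewrite derive_sum//; congr (_ *: _); apply: eq_bigr => i _; rewrite mxE.
Qed.

Lemma Favg_gdfield z : Favg f z = gdfield (favg f) z.
Proof.
rewrite gdfieldE grad_favg /= fct_sumE linearZ linear_sum.
by [].
Qed.

Lemma differentiable_grad_favg z : differentiable (grad (favg f)) z.
Proof.
rewrite grad_favg; apply: differentiableZ; apply: differentiable_sum => i.
exact: (f_diff2 i).2.
Qed.

Lemma similarity_lipschitz delta i z1 z2 : second_order_similarity f delta ->
  enorm ((Fc f i z1 - Favg f z1) - (Fc f i z2 - Favg f z2))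
  <= delta * enorm (z1 - z2).
Proof.
move=> sim; rewrite !Favg_gdfield /Fc !gdfieldE -!linearB enorm_flip.
apply: (@hessian_lipschitz _ _ (grad (f i) - grad (favg f))) => z.
  apply: differentiableB; [exact: (f_diff2 i).2|exact: differentiable_grad_favg].
suff -> : 'J (grad (f i) - grad (favg f)) z =
  hessian (f i) z - hessian (favg f) z by exact: sim.
apply: jacobianB; [exact: (f_diff2 i).2|exact: differentiable_grad_favg].
Qed.

End second_order.

Lemma Favg_lipschitz L z1 z2 : (0 < n)%N -> smooth f L ->
  enorm (Favg f z1 - Favg f z2) <= L * enorm (z1 - z2).
Proof.
move=> n0 sm; rewrite -scalerBr -sumrB enormZ ger0_norm ?invr_ge0//.
rewrite ler_pdivrMl ?ltr0n//.
rewrite (le_trans (enorm_sum _ _ _))//.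
have -> : n%:R * (L * enorm (z1 - z2)) = \sum_(i < n) (L * enorm (z1 - z2)).
  by rewrite sumr_const card_ord mulr_natl.
by apply: ler_sum => i _.
Qed.

Lemma enorm_Favg_le z c : (0 < n)%N -> (forall i, enorm (Fc f i z) <= c) ->
  enorm (Favg f z) <= c.
Proof.
move=> n0 Fc_le; rewrite enormZ ger0_norm ?invr_ge0// ler_pdivrMl ?ltr0n//.
rewrite (le_trans (enorm_sum _ _ _))//.
have -> : n%:R * c = \sum_(i < n) c by rewrite sumr_const card_ord mulr_natl.
by apply: ler_sum => i _.
Qed.

Lemma prodset_conv (X : set 'rV[R]_dx) (Y : set 'rV[R]_dy) (z1 z2 : V) (t : R) :
  convex_set (prodset X Y) -> 0 < t -> t < 1 ->
  prodset X Y z1 -> prodset X Y z2 -> prodset X Y (z1 + t *: (z2 - z1)).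
Proof.
move=> cvx t0 t1 Z1 Z2.
have := cvx z2 z1 (Itv01 (ltW t0) (ltW t1)); rewrite !inE => /(_ Z2 Z1).
suff -> : z1 + t *: (z2 - z1) = t *: z2 + (1 - t) *: z1 by [].
by rewrite scalerBr scalerBl scale1r addrCA addrA.
Qed.

(** A saddle point minimises in x and maximises in y separately, so each block moves towards [zz] on
    its own. [eta] times the sum of the two first-order conditions is the claim, as
    [2 * eta * c = 1]. *)
Lemma saddle_variational (X : set 'rV[R]_dx) (Y : set 'rV[R]_dy) i eta v uh zz :
  0 < eta -> convex_set (prodset X Y) ->
  differentiable (f i : V -> R^o) uh ->
  saddle_point X Y (svogs_objective f i eta v) uh -> prodset X Y zz ->
  0 <= dot (eta *: Fc f i uh + (uh - v)) (zz - uh).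
Proof.
move=> eta0 cvx df [Zu sad] Zz; set c := (2 * eta)^-1.
have conv t : 0 < t -> t < 1 ->
    X (lsubmx uh + t *: (lsubmx zz - lsubmx uh)) /\
    Y (rsubmx uh + t *: (rsubmx zz - rsubmx uh)).
  move=> t0 t1; have := prodset_conv cvx t0 t1 Zu Zz; rewrite /prodset/=.
  suff [-> ->] : lsubmx (uh + t *: (zz - uh)) =
        lsubmx uh + t *: (lsubmx zz - lsubmx uh) /\
      rsubmx (uh + t *: (zz - uh)) = rsubmx uh + t *: (rsubmx zz - rsubmx uh).
    by [].
  by split; apply/rowP => j; rewrite !mxE.
have sqD (k : nat) (p q : 'rV[R]_k) t : enorm (p + t *: q) ^+ 2 =
    enorm p ^+ 2 + 2 * t * dot p q + t ^+ 2 * enorm q ^+ 2.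
  by rewrite !sqr_enorm !(dotDl, dotDr, dotZl, dotZr) (dotC q p); ring.
set hx := lsubmx (zz - uh); set hy := rsubmx (zz - uh).
pose px := lsubmx uh - lsubmx v; pose py := rsubmx uh - rsubmx v.
have Hx : 0 <= dot (grad (f i) uh) (row_mx hx 0) + c * (2 * dot px hx).
  apply: (@first_order_ge0 _ _ _ _ _ _ (c * enorm hx ^+ 2)) => // t t0 t1.
  have [Xt _] := conv t t0 t1.
  have := (sad _ _ Xt Zu.2).2; rewrite /svogs_objective !row_mxKl !row_mxKr.
  have -> : row_mx (lsubmx uh + t *: (lsubmx zz - lsubmx uh)) (rsubmx uh) =
      uh + t *: row_mx hx 0.
    rewrite -[in RHS](hsubmxK uh) scale_row_mx add_row_mx scaler0 addr0.
    by rewrite /hx lsubmxB.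
  have -> : lsubmx uh + t *: (lsubmx zz - lsubmx uh) - lsubmx v = px + t *: hx.
    by rewrite /hx lsubmxB [LHS]addrAC.
  rewrite -/c -/px sqD; lra.
(* Maximising in y is minimising for [- f i]; the x-penalty is the same on both sides and
   cancels. *)
have Hy : 0 <= dot (grad (- f i) uh) (row_mx 0 hy) + c * (2 * dot py hy).
  apply: (@first_order_ge0 _ _ _ _ _ _ (c * enorm hy ^+ 2)) => [|t t0 t1].
    exact: differentiableN.
  have [_ Yt] := conv t t0 t1.
  have := (sad _ _ Zu.1 Yt).1; rewrite /svogs_objective !row_mxKl !row_mxKr.
  have -> : row_mx (lsubmx uh) (rsubmx uh + t *: (rsubmx zz - rsubmx uh)) =
      uh + t *: row_mx 0 hy.
    rewrite -[in RHS](hsubmxK uh) scale_row_mx add_row_mx scaler0 addr0.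
    by rewrite /hy rsubmxB.
  have -> : rsubmx uh + t *: (rsubmx zz - rsubmx uh) - rsubmx v = py + t *: hy.
    by rewrite /hy rsubmxB [LHS]addrAC.
  rewrite -/c -/py sqD /= !fctE; lra.
have gN : grad (- f i) uh = - grad (f i) uh.
  by apply/rowP => j; rewrite !mxE deriveN//; exact: diff_derivable.
rewrite dotDl dotZl dot_gdfield -gN -/hx -/hy [dot (uh - v) _]dot_submx.
rewrite -/hx -/hy lsubmxB rsubmxB -/px -/py.
have : 0 <= eta * (dot (grad (f i) uh) (row_mx hx 0) + c * (2 * dot px hx) +
  (dot (grad (- f i) uh) (row_mx 0 hy) + c * (2 * dot py hy))).
  by apply: mulr_ge0; [exact: ltW|exact: addr_ge0].
suff -> : forall a b p q, eta * (a + c * (2 * p) + (b + c * (2 * q))) =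
  eta * (a + b) + (p + q) by [].
by move=> a b p q; rewrite /c; field; rewrite gt_eqF.
Qed.
End gradient_field.

(** * Expectation over independent draws *)

Section product_expectation.
Context {R : realType} {I T : finType}.
Variable q : T -> R.
Hypothesis q_ge0 : forall t, 0 <= q t.
Hypothesis q_sum1 : \sum_t q t = 1.
Implicit Types (om : {ffun I -> T}) (Q : {ffun I -> T} -> R).

(** Used at two levels: over the iterations, each drawing a batch and a coin, and over the slots of
    one batch, each drawing an index. *)
Definition prod_expect Q : R :=
  \sum_(om : {ffun I -> T}) (\prod_i q (om i)) * Q om.

(** Independence from draw [i] is stated as invariance under [upd _ i _]; conditioning on the other
    draws is averaging over [t] at [upd om i t]. *)
Definition upd om i t : {ffun I -> T} := [ffun j => if j == i then t else om j].

Lemma upd_same om i t : upd om i t i = t.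
Proof. by rewrite ffunE eqxx. Qed.

Lemma upd_diff om i t j : j != i -> upd om i t j = om j.
Proof. by rewrite ffunE => /negPf ->. Qed.

Lemma prod_expectD Q1 Q2 :
  prod_expect (fun om => Q1 om + Q2 om) = prod_expect Q1 + prod_expect Q2.
Proof. by rewrite -big_split; apply: eq_bigr => om _; rewrite mulrDr. Qed.

Lemma prod_expectZ c Q : prod_expect (fun om => c * Q om) = c * prod_expect Q.
Proof. by rewrite mulr_sumr; apply: eq_bigr => om _; rewrite mulrCA. Qed.

Lemma prod_expect_sum (J : Type) (r : seq J) (P : pred J)
    (Q : J -> {ffun I -> T} -> R) :
  prod_expect (fun om => \sum_(j <- r | P j) Q j om) =
  \sum_(j <- r | P j) prod_expect (Q j).
Proof.
by rewrite exchange_big; apply: eq_bigr => om _; rewrite mulr_sumr.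
Qed.

Lemma prod_expect_ext Q1 Q2 : Q1 =1 Q2 -> prod_expect Q1 = prod_expect Q2.
Proof. by move=> Q12; apply: eq_bigr => om _; rewrite Q12. Qed.

Lemma prod_expect_le Q1 Q2 :
  (forall om, Q1 om <= Q2 om) -> prod_expect Q1 <= prod_expect Q2.
Proof. by move=> Q12; apply: ler_sum => om _; rewrite ler_wpM2l// prodr_ge0. Qed.

Lemma prod_expect_cst c : prod_expect (fun=> c) = c.
Proof.
rewrite /prod_expect -mulr_suml -(bigA_distr_bigA (fun _ => q)).
by rewrite big1 ?mul1r.
Qed.

(* Exchanging the resampled value with the i-th draw is a weight-preserving
   involution of the pairs (om, t). *)
Lemma prod_expect_resample i Q :
  prod_expect Q = prod_expect (fun om => \sum_t q t * Q (upd om i t)).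
Proof.
pose h (x : {ffun I -> T} * T) := (upd x.1 i x.2, x.1 i).
have hK : involutive h.
  case=> om t; rewrite /h /= upd_same; congr (_, _).
  by apply/ffunP => j; rewrite !ffunE; case: eqP => // ->.
rewrite /prod_expect; under [RHS]eq_bigr do rewrite mulr_sumr.
rewrite pair_big (reindex_inj (inv_inj hK)) /=.
under [LHS]eq_bigr => om _ do rewrite -[_ * _]mul1r -{1}q_sum1 mulr_suml.
rewrite pair_big; apply: eq_bigr => -[om t] _ /=.
have -> : upd (upd om i t) i (om i) = om by have [] := hK (om, t).
rewrite (bigD1 i)//= [in RHS](bigD1 i)//= upd_same.
under [in RHS]eq_bigr => j ji do rewrite (upd_diff _ _ ji).
ring.
Qed.

Lemma prod_expect_resample_le i Q Q' :
  (forall om, \sum_t q t * Q (upd om i t) <= Q' om) ->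
  prod_expect Q <= prod_expect Q'.
Proof. by move=> QQ'; rewrite (prod_expect_resample i); exact: prod_expect_le. Qed.

Lemma prod_expect_dot0 m i (X H : {ffun I -> T} -> 'rV[R]_m) :
  (forall om t, H (upd om i t) = H om) ->
  (forall om v, \sum_t q t * dot (X (upd om i t)) v = 0) ->
  prod_expect (fun om => dot (X om) (H om)) = 0.
Proof.
move=> Hi Xi; rewrite (prod_expect_resample i) -[RHS](prod_expect_cst 0).
apply: prod_expect_ext => om; rewrite -[RHS](Xi om (H om)).
by apply: eq_bigr => t _; rewrite Hi.
Qed.

End product_expectation.

(** In a cross term with [j < k], [X j] does not see draw [k] while [X k] has mean zero when that
    draw is resampled, so the term vanishes. *)
Lemma martingale_sqnorm (R : realType) (K m : nat) (T : finType) (q : T -> R)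
    (X : 'I_K -> {ffun 'I_K -> T} -> 'rV[R]_m) :
  \sum_t q t = 1 ->
  (forall j k : 'I_K, (j < k)%N -> forall om t, X j (upd om k t) = X j om) ->
  (forall k om v, \sum_t q t * dot (X k (upd om k t)) v = 0) ->
  prod_expect q (fun om => enorm (\sum_k X k om) ^+ 2) =
  \sum_k prod_expect q (fun om => enorm (X k om) ^+ 2).
Proof.
move=> q1 Xpast Xctr.
under prod_expect_ext => om do rewrite sqr_enorm dot_suml.
rewrite prod_expect_sum; apply: eq_bigr => k _.
under prod_expect_ext => om do rewrite dot_sumr.
rewrite prod_expect_sum (bigD1 k)//= [X in _ + X]big1 => [|j].
  by rewrite addr0; apply: prod_expect_ext => om; rewrite sqr_enorm.
rewrite neq_ltn => /orP[jk|kj].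
  by apply: (prod_expect_dot0 q1 (i := k)) => // om t; exact: Xpast.
under prod_expect_ext => om do rewrite dotC.
by apply: (prod_expect_dot0 q1 (i := j)) => // om t; exact: Xpast.
Qed.

(** * Mini-batches and the law of one iteration *)

Section minibatch.
Context {R : realType} {n b : nat}.
Hypothesis n_gt0 : (0 < n)%N.

Lemma sum_uniform : \sum_(i < n) n%:R^-1 = 1 :> R.
Proof. by rewrite sumr_const card_ord -[LHS]mulr_natr mulVf ?pnatr_eq0 -?lt0n. Qed.

Local Notation Ebatch := (@prod_expect R 'I_b 'I_n (fun=> n%:R^-1)).

(** The slots are independent and centred, so the squared norm of the sum splits into [b] terms of
    mean at most [c]; the factor [1/b^2] leaves [c/b]. *)
Lemma batch_sqnorm_le m (Y : 'I_n -> 'rV[R]_m) c :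
  (0 < b)%N -> \sum_i Y i = 0 -> (forall i, enorm (Y i) ^+ 2 <= c) ->
  Ebatch (fun S => enorm (b%:R^-1 *: \sum_l Y (S l)) ^+ 2) <= b%:R^-1 * c.
Proof.
move=> b0 Y0 Yc.
under prod_expect_ext => S do
  rewrite enormZ exprMn ger0_norm ?invr_ge0//.
rewrite prod_expectZ (martingale_sqnorm sum_uniform (X := fun l S => Y (S l))).
- rewrite expr2 -mulrA ler_wpM2l ?invr_ge0// ler_pdivrMl ?ltr0n//.
  have -> : b%:R * c = \sum_(l < b) c by rewrite sumr_const card_ord mulr_natl.
  apply: ler_sum => l _.
  by rewrite -[leRHS](prod_expect_cst (I := 'I_b) sum_uniform) prod_expect_le.
- move=> j k jk S t; rewrite upd_diff//.
  by apply: contraTneq jk => ->; rewrite ltnn.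
- move=> k S v; under eq_bigr do rewrite upd_same.
  by rewrite -mulr_sumr -dot_suml Y0 dot0l mulr0.
Qed.

Lemma batch_mean0 m (Y : 'I_n -> 'rV[R]_m) v : \sum_i Y i = 0 ->
  Ebatch (fun S => dot (b%:R^-1 *: \sum_l Y (S l)) v) = 0.
Proof.
move=> Y0; under prod_expect_ext => S do rewrite dotZl dot_suml.
rewrite prod_expectZ prod_expect_sum big1 ?mulr0// => l _.
apply: (prod_expect_dot0 sum_uniform (i := l) (H := fun=> v)) => // S h.
under eq_bigr do rewrite upd_same.
by rewrite -mulr_sumr -dot_suml Y0 dot0l mulr0.
Qed.

(** [outcome_prob p] is the product of these weights, so [expect p] is a [prod_expect] by
    conversion. *)
Definition iter_weight (p : R) (t : {ffun 'I_b -> 'I_n} * bool) : R :=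
  (\prod_(l < b) n%:R^-1) * (if t.2 then p else 1 - p).

Lemma iter_weight_ge0 p t : 0 <= p -> p <= 1 -> 0 <= iter_weight p t.
Proof.
move=> p0 p1; apply: mulr_ge0; last by case: t.2; rewrite // subr_ge0.
by apply: prodr_ge0 => l _; rewrite invr_ge0.
Qed.

Lemma sum_iter_weight p (g : {ffun 'I_b -> 'I_n} * bool -> R) :
  \sum_t iter_weight p t * g t =
  Ebatch (fun S => p * g (S, true) + (1 - p) * g (S, false)).
Proof.
under eq_bigr do rewrite [X in iter_weight _ X * g X]surjective_pairing.
rewrite -(pair_bigA _ (fun S c => iter_weight p (S, c) * g (S, c))) /=.
apply: eq_bigr => S _; rewrite big_bool /iter_weight /=; ring.
Qed.

Lemma sum_iter_weight1 p : \sum_t iter_weight p t = 1.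
Proof.
under eq_bigr do rewrite -[iter_weight _ _]mulr1.
rewrite sum_iter_weight -[RHS](prod_expect_cst (I := 'I_b) sum_uniform).
by apply: prod_expect_ext => S; ring.
Qed.

End minibatch.

(** * The pathwise inequality *)

(** Applied with [r = eta * delta], [al = |uh - z_k|], [be = |uh - w_k|], [s = |u - uh|],
    [d = |z_k - z_(k-1)|], [ua = |u - z_k|], [uw = |u - w_k|]. As [s <= al / 10], the negative
    squares of [al] and [be] pay for the positive terms, up to [d ^+ 2 / 64], and still leave
    negative squares of [ua] and [uw]. *)
Lemma step_absorb (R : realType) (g r al be s d ua uw : R) :
  0 <= g -> g <= 9^-1 -> 0 <= r -> r <= 32^-1 ->
  0 <= al -> 0 <= be -> 0 <= s -> 0 <= d -> 0 <= ua -> 0 <= uw ->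
  s <= al / 10 -> ua <= al + s -> uw <= be + s ->
  r * ua * s + r * d * al + al ^+ 2 / 4 + s ^+ 2 / 2
  - (1 - g) / 2 * al ^+ 2 - g / 2 * be ^+ 2 <=
  d ^+ 2 / 64 - ua ^+ 2 / 8 - 2 / 5 * g * uw ^+ 2.
Proof.
move=> g0 g9 r0 r32 al0 be0 s0 d0 ua0 uw0 sal uas uws.
have ua_al : ua <= 11 / 10 * al by lra.
have uw_al : uw <= be + al / 10 by lra.
have h1 : r * ua * s <= 32^-1 * (11 / 10 * al) * (al / 10).
  by rewrite !ler_pM// mulr_ge0.
have h2 : r * (d * al) <= 32^-1 * (d * al) by rewrite ler_wpM2r// mulr_ge0.
have h3 : d * al <= (d ^+ 2 + al ^+ 2) / 2.
  by have := sqr_ge0 (d - al); rewrite sqrrB; lra.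
have h4 : s ^+ 2 <= (al / 10) ^+ 2 by rewrite ler_pXn2r ?nnegrE//; lra.
have h5 : ua ^+ 2 <= (11 / 10 * al) ^+ 2 by rewrite ler_pXn2r ?nnegrE//; lra.
(* The factor [11 / 10] is small enough that [2/5 * 11/10 < 1/2], the available weight of
   [g * be ^+ 2]. *)
have h6 : uw ^+ 2 <= 11 / 10 * be ^+ 2 + 11 / 100 * al ^+ 2.
  apply: (@le_trans _ _ ((be + al / 10) ^+ 2)).
    by rewrite ler_pXn2r ?nnegrE//; lra.
  by have := sqr_ge0 (be - al); rewrite sqrrB sqrrD; lra.
have h7 : g * uw ^+ 2 <= g * (11 / 10 * be ^+ 2 + 11 / 100 * al ^+ 2).
  by rewrite ler_wpM2l.
have h8 : g * al ^+ 2 <= 9^-1 * al ^+ 2 by rewrite ler_wpM2r ?sqr_ge0.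
have h9 : 0 <= g * be ^+ 2 by rewrite mulr_ge0 ?sqr_ge0.
have h10 := sqr_ge0 al.
have -> : r * d * al = r * (d * al) by ring.
lra.
Qed.

(** * One iteration, and its sum along a path *)

Section one_step.
Context {R : realType} {m : nat}.
Local Notation V := 'rV[R]_m.
Variables (F F1 : V -> V) (L delta eta gamma D M : R).
Local Notation G z := (F z - F1 z).
Hypothesis F_lip : forall z1 z2, enorm (F z1 - F z2) <= L * enorm (z1 - z2).
Hypothesis G_lip : forall z1 z2, enorm (G z1 - G z2) <= delta * enorm (z1 - z2).
Hypothesis delta_ge0 : 0 <= delta.
Hypothesis delta_leL : delta <= L.
Hypothesis eta_ge0 : 0 <= eta.
Hypothesis eta_delta : eta * delta <= 32^-1.
Hypothesis gamma_ge0 : 0 <= gamma.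
Hypothesis gamma_le : gamma <= 9^-1.

(** Here [a], [ap], [w] are z_k, z_(k-1), w_k, [xi] is the batch noise, and [uh], [u] are the exact
    and the computed solutions. The variational inequality at [zz] is rewritten in terms of [u]: the
    linear cost of this is [tol], the quadratic one goes to [step_absorb]. *)
Lemma one_step (a ap w xi uh u zz : V) (tol : R) :
  0 <= dot (eta *: F1 uh + (uh - ((1 - gamma) *: a + gamma *: w
              - eta *: (G a + (G a - G ap) + xi)))) (zz - uh) ->
  enorm (uh - zz) <= D -> enorm (u - uh) <= D ->
  enorm (F uh) <= M + L * D ->
  enorm (u - uh) <= enorm (uh - a) / 10 ->
  enorm (u - uh) * (4 * eta * L * D + eta * M + D) <= tol ->
  eta * dot (F u) (u - zz) <= tol
    + eta * dot (G u - G a) (u - zz) - eta * dot (G a - G ap) (a - zz)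
    - eta * dot xi (a - zz) + eta ^+ 2 * enorm xi ^+ 2
    + (1 - gamma) / 2 * (enorm (a - zz) ^+ 2 - enorm (u - zz) ^+ 2)
    + gamma / 2 * (enorm (w - zz) ^+ 2 - enorm (u - zz) ^+ 2)
    + enorm (a - ap) ^+ 2 / 64 - enorm (u - a) ^+ 2 / 8
    - 2 / 5 * gamma * enorm (u - w) ^+ 2.
Proof.
move=> VI uhD sD FuhM s10 stol.
set s := enorm (u - uh) in sD s10 stol *.
have s0 : 0 <= s := enorm_ge0 _.
have L0 : 0 <= L := le_trans delta_ge0 delta_leL.
have D0 : 0 <= D := le_trans s0 sD.
have uzzD : enorm (u - zz) <= 2 * D.
  by rewrite (le_trans (enormB_trans uh _ _))// -/s; lra.
(* [i1] to [i3] cost [(4 * L * D + M) * s] before the factor [eta], and [i7], once halved, costs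
   [D * s]: together the left side of the hypothesis on [tol]. *)
have i1 : dot (F u - F uh) (u - zz) <= (L * s) * (2 * D).
  exact: dot_le_of.
have i2 : dot (F uh) (u - uh) <= (M + L * D) * s by exact: dot_le_of.
have i3 : dot (G uh - G u) (uh - zz) <= (L * s) * D.
  apply: dot_le_of => //; rewrite (le_trans (G_lip _ _))// enormBC.
  by rewrite ler_wpM2r ?enorm_ge0.
have i4 : dot (G u - G a) (uh - u) <= delta * enorm (u - a) * s.
  by apply: dot_le_of; rewrite // enormBC.
have i5 : - dot (G a - G ap) (uh - a) <= delta * enorm (a - ap) * enorm (uh - a).
  by rewrite -dotNr; apply: dot_le_of; rewrite // enormN.
(* [uh] depends on the current batch, so this pairing need not be centred; Young's inequality with
   weight 1 replaces it by squares. *)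
have i6 : - (eta * dot xi (uh - a)) <= eta ^+ 2 * enorm xi ^+ 2 + enorm (uh - a) ^+ 2 / 4.
  rewrite -mulrN -dotNr -dotZl (le_trans (dot_young _ _ ltr01))//.
  by rewrite enormN enormZ (ger0_norm eta_ge0) exprMn; lra.
have i7 : enorm (u - zz) ^+ 2 <= enorm (uh - zz) ^+ 2 + 2 * (s * D) + s ^+ 2.
  have -> : u - zz = (uh - zz) + (u - uh) by rewrite [RHS]addrC addrA subrK.
  rewrite sqr_enormD -/s.
  have : dot (uh - zz) (u - uh) <= D * s by exact: dot_le_of.
  lra.
have abs := step_absorb gamma_ge0 gamma_le (mulr_ge0 eta_ge0 delta_ge0) eta_delta
  (enorm_ge0 (uh - a)) (enorm_ge0 (uh - w)) s0 (enorm_ge0 (a - ap))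
  (enorm_ge0 (u - a)) (enorm_ge0 (u - w)) s10.
have uas : enorm (u - a) <= enorm (uh - a) + s.
  by rewrite [leRHS]addrC; exact: enormB_trans.
have uws : enorm (u - w) <= enorm (uh - w) + s.
  by rewrite [leRHS]addrC; exact: enormB_trans.
have {abs uas uws} abs := abs uas uws.
have j1 : eta * dot (F u) (u - zz) <=
    eta * dot (F uh) (uh - zz) + eta * (3 * L * D + M) * s.
  have -> : dot (F u) (u - zz) = dot (F uh) (uh - zz) +
      (dot (F u - F uh) (u - zz) + dot (F uh) (u - uh)).
    by rewrite !(dotBl, dotBr); ring.
  rewrite mulrDr lerD2l -mulrA ler_wpM2l//; lra.
have j2 : eta * dot (G uh - G a) (uh - zz) <= eta * dot (G u - G a) (u - zz)
    + eta * L * D * s + (eta * delta) * enorm (u - a) * s.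
  have -> : dot (G uh - G a) (uh - zz) = dot (G u - G a) (u - zz) +
     (dot (G uh - G u) (uh - zz) + dot (G u - G a) (uh - u)).
    by move: (G uh) (G u) (G a) => x y z; rewrite !(dotBl, dotBr); ring.
  rewrite mulrDr.
  have := ler_wpM2l eta_ge0 (lerD i3 i4); lra.
have j3 : - (eta * dot (G a - G ap) (uh - zz)) <= - (eta * dot (G a - G ap) (a - zz))
    + (eta * delta) * enorm (a - ap) * enorm (uh - a).
  have -> : dot (G a - G ap) (uh - zz) = dot (G a - G ap) (a - zz) +
     dot (G a - G ap) (uh - a) by rewrite -dotDr [a - zz + _]addrC addrA subrK.
  have := ler_wpM2l eta_ge0 i5; lra.
have j4 : - (eta * dot xi (uh - zz)) <= - (eta * dot xi (a - zz))
    + eta ^+ 2 * enorm xi ^+ 2 + enorm (uh - a) ^+ 2 / 4.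
  have -> : dot xi (uh - zz) = dot xi (a - zz) + dot xi (uh - a).
    by rewrite -dotDr [a - zz + _]addrC addrA subrK.
  lra.
(* The variational inequality with [F = F1 + G]; polarising [<uh - a, zz - uh>] and
   [<uh - w, zz - uh>] yields the squared distances. *)
have j5 : eta * dot (F uh) (uh - zz) <= eta * dot (G uh - G a) (uh - zz)
    - eta * dot (G a - G ap) (uh - zz) - eta * dot xi (uh - zz)
    - enorm (uh - zz) ^+ 2 / 2 + (1 - gamma) / 2 * enorm (a - zz) ^+ 2
    + gamma / 2 * enorm (w - zz) ^+ 2 - (1 - gamma) / 2 * enorm (uh - a) ^+ 2
    - gamma / 2 * enorm (uh - w) ^+ 2.
  have -> : dot (F uh) (uh - zz) = dot (F1 uh) (uh - zz) + dot (G uh) (uh - zz).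
    by rewrite [dot (G uh) _]dotBl [RHS]addrC subrK.
  move: VI; move: (G uh) (G a) (G ap) (F1 uh) => x y z t.
  rewrite !sqr_enorm !(dotBl, dotBr, dotNl, dotNr, dotDl, dotDr, dotZl, dotZr).
  rewrite (dotC zz uh) (dotC a uh) (dotC w uh) (dotC zz a) (dotC zz w); lra.
lra.
Qed.

(** Replacing the weight [gamma] by the coin turns the left side into a telescoping increment. The
    error carries the factor [b%:R - gamma], and recentring it at [c] leaves [zz] only in a linear
    term. *)
Lemma coin_sqdist (b : bool) (u w w' c zz : V) :
  w' = (if b then u else w) ->
  gamma / 2 * (enorm (w - zz) ^+ 2 - enorm (u - zz) ^+ 2) =
  enorm (w - zz) ^+ 2 / 2 - enorm (w' - zz) ^+ 2 / 2
  + (b%:R - gamma) / 2 * (enorm (u - c) ^+ 2 - enorm (w - c) ^+ 2)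
  - dot ((b%:R - gamma) *: (u - w)) (zz - c).
Proof.
move=> ->; have -> : enorm (u - c) ^+ 2 - enorm (w - c) ^+ 2 =
    enorm (u - zz) ^+ 2 - enorm (w - zz) ^+ 2 + 2 * dot (u - w) (zz - c).
  rewrite !sqr_enorm !(dotBl, dotBr).
  by rewrite (dotC zz u) (dotC zz w) (dotC c u) (dotC c w); ring.
by rewrite dotZl; case: b => /=; field.
Qed.

Lemma pathwise_bound K (Z W : nat -> V) (UH XI : 'I_K -> V) (chi : 'I_K -> bool)
    (c zz : V) (tol : R) :
  Z 0%N = c -> W 0%N = c ->
  (forall k : 'I_K, W k.+1 = if chi k then Z k.+1 else W k) ->
  (forall k : 'I_K,
     0 <= dot (eta *: F1 (UH k) + (UH k - ((1 - gamma) *: Z k + gamma *: W k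
       - eta *: (G (Z k) + (G (Z k) - G (Z k.-1)) + XI k)))) (zz - UH k)) ->
  (forall k, enorm (UH k - zz) <= D) ->
  (forall k, enorm (F (UH k)) <= M + L * D) ->
  (forall k : 'I_K, enorm (Z k.+1 - UH k) <= D) ->
  (forall k : 'I_K, enorm (Z k.+1 - UH k) <= enorm (UH k - Z k) / 10) ->
  (forall k : 'I_K,
     enorm (Z k.+1 - UH k) * (4 * eta * L * D + eta * M + D) <= tol) ->
  enorm (c - zz) <= D ->
  (forall k, (k <= K)%N -> enorm (Z k - zz) <= 2 * D) ->
  eta * \sum_(k < K) dot (F (Z k.+1)) (Z k.+1 - zz) <=
  K%:R * tol + 21 / 4 * D ^+ 2
  + 2^-1 * \sum_(k < K) ((chi k)%:R - gamma)
      * (enorm (Z k.+1 - c) ^+ 2 - enorm (W k - c) ^+ 2)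
  + 8^-1 * enorm (\sum_(k < K) ((chi k)%:R - gamma) *: (Z k.+1 - W k)) ^+ 2
  + 8^-1 * enorm (\sum_(k < K) eta *: XI k) ^+ 2
  - eta * \sum_(k < K) dot (XI k) (Z k - c)
  + \sum_(k < K) (eta ^+ 2 * enorm (XI k) ^+ 2 + enorm (Z k - Z k.-1) ^+ 2 / 64
             - enorm (Z k.+1 - Z k) ^+ 2 / 8
             - 2 / 5 * gamma * enorm (Z k.+1 - W k) ^+ 2).
Proof.
move=> Zc Wc Wn VI UHD FUH sD s10 stol cD ZD.
pose T k := eta * dot (G (Z k) - G (Z k.-1)) (Z k - zz)
  - (1 - gamma) / 2 * enorm (Z k - zz) ^+ 2 - enorm (W k - zz) ^+ 2 / 2.
pose rest (k : 'I_K) := eta ^+ 2 * enorm (XI k) ^+ 2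
  + enorm (Z k - Z k.-1) ^+ 2 / 64 - enorm (Z k.+1 - Z k) ^+ 2 / 8
  - 2 / 5 * gamma * enorm (Z k.+1 - W k) ^+ 2.
(* [dT] is opaque so that [big_split] keeps the telescoping sum in one piece. *)
have [dT dTE] : {dT | forall k : 'I_K, dT k = T k.+1 - T k} by eexists=> k.
have step (k : 'I_K) : eta * dot (F (Z k.+1)) (Z k.+1 - zz) <=
    tol + dT k
    + 2^-1 * (((chi k)%:R - gamma)
        * (enorm (Z k.+1 - c) ^+ 2 - enorm (W k - c) ^+ 2))
    - dot (((chi k)%:R - gamma) *: (Z k.+1 - W k)) (zz - c)
    + dot (eta *: XI k) (zz - c) - eta * dot (XI k) (Z k - c) + rest k.
  have := one_step (VI k) (UHD k) (sD k) (FUH k) (s10 k) (stol k).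
  rewrite (coin_sqdist c zz (Wn k)) dTE /T /rest /=.
  have -> : dot (XI k) (Z k - zz) = dot (XI k) (Z k - c) - dot (XI k) (zz - c).
    by rewrite -dotBr opprB addrA subrK.
  rewrite dotZl; lra.
have tele : \sum_(k < K) dT k = T K - T 0%N.
  under eq_bigr do rewrite dTE.
  by rewrite -(big_mkord xpredT (fun k => T k.+1 - T k)) telescope_sumr.
(* Since [0.-1 = 0], the inner product in [T 0] vanishes. *)
have T0 : - D ^+ 2 <= T 0%N.
  have cD2 : enorm (c - zz) ^+ 2 <= D ^+ 2.
    by rewrite ler_pXn2r// nnegrE ?enorm_ge0// (le_trans _ cD) ?enorm_ge0.
  rewrite /T /= subrr dot0l mulr0 Zc Wc.
  have := mulr_ge0 gamma_ge0 (sqr_ge0 (enorm (c - zz))); lra.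
(* The iterates are within [2 * D] of [zz], so the inner product is at most
   [eta * delta * 8 * D ^+ 2 <= D ^+ 2 / 4]. *)
have TK : T K <= D ^+ 2 / 4.
  have D0 : 0 <= D by rewrite (le_trans _ cD) ?enorm_ge0.
  have g1 : 0 <= (1 - gamma) / 2 by have := gamma_le; lra.
  have h1 := mulr_ge0 g1 (sqr_ge0 (enorm (Z K - zz))).
  have h2 := sqr_ge0 (enorm (W K - zz)).
  suff : eta * dot (G (Z K) - G (Z K.-1)) (Z K - zz) <= D ^+ 2 / 4.
    by rewrite /T => h3; lra.
  have ZZ : enorm (Z K - Z K.-1) <= 4 * D.
    rewrite (le_trans (enormB_trans zz _ _))// enormBC.
    have h3 := ZD K (leqnn K); have h4 := ZD K.-1 (leq_pred K).
    rewrite enormBC; rewrite (enormBC zz); lra.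
  have : dot (G (Z K) - G (Z K.-1)) (Z K - zz) <= (delta * (4 * D)) * (2 * D).
    by apply: dot_le_of; [rewrite (le_trans (G_lip _ _))// ler_wpM2l|exact: ZD].
  move=> /(ler_wpM2l eta_ge0) h; apply: (le_trans h).
  have := ler_wpM2r (sqr_ge0 D) eta_delta; lra.
(* The constant [21 / 4] is 1 from [T 0], 1/4 from [T K], and 2 from each use of this bound, on the
   coin sum and on the noise sum. *)
have young (x : V) : dot x (zz - c) <= 2 * D ^+ 2 + 8^-1 * enorm x ^+ 2.
  rewrite dotC (le_trans (dot_young _ _ (_ : 0 < 2)))// enormBC.
  have : enorm (c - zz) ^+ 2 <= D ^+ 2.
    by rewrite ler_pXn2r// nnegrE ?enorm_ge0// (le_trans _ cD) ?enorm_ge0.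
  have -> : (4 * 2)^-1 = 8^-1 :> R by congr (_^-1); ring.
  lra.
have := young (\sum_(k < K) eta *: XI k).
have := young (- \sum_(k < K) ((chi k)%:R - gamma) *: (Z k.+1 - W k)).
rewrite enormN dotNl !dot_suml => y1 y2.
rewrite mulr_sumr; apply: le_trans (ler_sum _ (fun k _ => step k)) _.
rewrite !big_split /= sumr_const card_ord tele !sumrN -!mulr_sumr -[tol *+ K]mulr_natl.
lra.
Qed.

End one_step.

(** * Moments of the noise *)

Section noise.
Context {R : realType} {m n b : nat}.
Local Notation V := 'rV[R]_m.
Variables (Fs : 'I_n -> V -> V) (F : V -> V).

(** A summand of the estimator minus its mean over the index; the part from [F_1], common to all
    indices, drops out. *)
Definition noise_term (z zp wp : V) (j : 'I_n) : V :=
  ((Fs j z - F z) - (Fs j wp - F wp)) + ((Fs j z - F z) - (Fs j zp - F zp)).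

Definition noise (S : 'I_b -> 'I_n) (z zp wp : V) : V :=
  b%:R^-1 *: \sum_l noise_term z zp wp (S l).

Lemma sum_noise_term z zp wp : (0 < n)%N ->
  (forall z', F z' = n%:R^-1 *: \sum_i Fs i z') ->
  \sum_j noise_term z zp wp j = 0.
Proof.
move=> n_gt0 FE; have ctr z' : \sum_j (Fs j z' - F z') = 0.
  rewrite sumrB sumr_const card_ord -[_ *+ n]scaler_nat FE scalerA.
  by rewrite divff ?pnatr_eq0 -?lt0n// scale1r subrr.
have sub0 z' : \sum_j ((Fs j z - F z) - (Fs j z' - F z')) = 0.
  by rewrite sumrB !ctr subrr.
by rewrite big_split/= !sub0 addr0.
Qed.

Lemma noise_term_sqnorm_le delta z zp wp j :
  (forall i z1 z2, enorm ((Fs i z1 - F z1) - (Fs i z2 - F z2))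
                   <= delta * enorm (z1 - z2)) ->
  enorm (noise_term z zp wp j) ^+ 2 <=
  2 * delta ^+ 2 * (enorm (z - wp) ^+ 2 + enorm (z - zp) ^+ 2).
Proof.
move=> lip; set p := enorm (z - wp); set q := enorm (z - zp).
have H : enorm (noise_term z zp wp j) <= delta * p + delta * q.
  by rewrite (le_trans (enormD _ _))// lerD.
apply: (@le_trans _ _ ((delta * p + delta * q) ^+ 2)).
  by rewrite ler_pXn2r// nnegrE ?enorm_ge0// (le_trans _ H) ?enorm_ge0.
by have := sqr_ge0 (delta * p - delta * q); rewrite sqrrB sqrrD; lra.
Qed.

End noise.

(** The difference telescopes to [h K - h 0]. This matches lagged distances with the negative terms,
    which sit one index later. *)
Lemma sum_shift_le (R : numDomainType) K (h : nat -> R) :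
  h 0%N = 0 -> (forall k, 0 <= h k) ->
  \sum_(k < K) h k <= \sum_(k < K) h k.+1.
Proof.
move=> h0 h_ge0; rewrite -subr_ge0 -sumrB.
by rewrite -(big_mkord xpredT (fun k => h k.+1 - h k)) telescope_sumr// h0 subr0.
Qed.

Section moments.
Context {R : realType} {m n b K : nat}.
Local Notation V := 'rV[R]_m.
Local Notation Omega := {ffun 'I_K -> {ffun 'I_b -> 'I_n} * bool}.
Variables (p : R) (Fs : 'I_n -> V -> V) (F : V -> V).
Variables (z w : nat -> Omega -> V).
Hypotheses (n_gt0 : (0 < n)%N) (b_gt0 : (0 < b)%N).
Hypotheses (p_ge0 : 0 <= p) (p_le1 : p <= 1).
(** Adaptedness: iterates up to index [k] do not see draw [k], and by [z_next] the iterate [z k.+1]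
    sees the batch of that draw but not its coin. *)
Hypothesis z_upd : forall (k : 'I_K) om t j,
  (j <= k)%N -> z j (upd om k t) = z j om.
Hypothesis w_upd : forall (k : 'I_K) om t j,
  (j <= k)%N -> w j (upd om k t) = w j om.
Hypothesis z_next : forall (k : 'I_K) om S c c',
  z k.+1 (upd om k (S, c)) = z k.+1 (upd om k (S, c')).
Hypothesis FE : forall v, F v = n%:R^-1 *: \sum_i Fs i v.

Local Notation E := (prod_expect (iter_weight p)).
Local Notation T := ({ffun 'I_b -> 'I_n} * bool)%type.
Let q_ge0 (t : T) : 0 <= iter_weight p t := iter_weight_ge0 t p_ge0 p_le1.
Let q_sum1 : \sum_(t : T) iter_weight p t = 1 := sum_iter_weight1 n_gt0 p.

Definition coin (k : 'I_K) (om : Omega) : R := ((om k).2 : nat)%:R - p.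

Definition xi (k : 'I_K) (om : Omega) : V :=
  noise Fs F (om k).1 (z k om) (z k.-1 om) (w k.-1 om).

Definition coin_free (k : 'I_K) (h : Omega -> R) :=
  forall om S c c', h (upd om k (S, c)) = h (upd om k (S, c')).

Lemma sum_coin0 k h om : coin_free k h ->
  \sum_t iter_weight p t * (coin k (upd om k t) * h (upd om k t)) = 0.
Proof.
move=> hk; rewrite sum_iter_weight.
rewrite -[RHS](prod_expect_cst (I := 'I_b) (sum_uniform n_gt0)).
apply: prod_expect_ext => S; rewrite /coin !upd_same (hk om S false true) /=; ring.
Qed.

Lemma expect_coin0 k h : coin_free k h -> E (fun om => coin k om * h om) = 0.
Proof.
move=> hk; rewrite (prod_expect_resample q_sum1 k).
rewrite -[RHS](prod_expect_cst (I := 'I_K) q_sum1).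
by apply: prod_expect_ext => om; exact: sum_coin0.
Qed.

Lemma expect_coin2 k h : coin_free k h ->
  E (fun om => coin k om ^+ 2 * h om) = p * (1 - p) * E h.
Proof.
move=> hk; rewrite (prod_expect_resample q_sum1 k) [E h](prod_expect_resample q_sum1 k).
rewrite -prod_expectZ; apply: prod_expect_ext => om.
rewrite !sum_iter_weight -prod_expectZ; apply: prod_expect_ext => S.
rewrite /coin !upd_same (hk om S false true) /=; ring.
Qed.

Lemma coin_free_next k (h : V -> V -> R) :
  coin_free k (fun om => h (z k.+1 om) (w k om)).
Proof. by move=> om S c c'; rewrite !w_upd// (z_next _ _ _ c c'). Qed.

Lemma expect_coin_sum_sqnorm_le :
  E (fun om => enorm (\sum_(k < K) coin k om *: (z k.+1 om - w k om)) ^+ 2) <=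
  p * E (fun om => \sum_(k < K) enorm (z k.+1 om - w k om) ^+ 2).
Proof.
rewrite (martingale_sqnorm (X := fun k om => coin k om *: (z k.+1 om - w k om)) q_sum1).
- rewrite prod_expect_sum mulr_sumr; apply: ler_sum => k _.
  under prod_expect_ext => om do rewrite enormZ exprMn real_normK ?num_real//.
  rewrite expect_coin2; last exact: (coin_free_next k (fun x y => enorm (x - y) ^+ 2)).
  rewrite -mulrA ler_wpM2l// ler_piMl ?gerBl//.
  rewrite -[leLHS](prod_expect_cst (I := 'I_K) q_sum1).
  by apply: prod_expect_le => // om; rewrite sqr_ge0.
- move=> j k jk om t; rewrite /coin z_upd// w_upd ?(ltnW jk)//.
  by rewrite upd_diff// neq_ltn jk.
- move=> k om v; under eq_bigr do rewrite dotZl.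
  exact: (sum_coin0 _ (coin_free_next k (fun x y => dot (x - y) v))).
Qed.

Lemma xi_upd k om t : xi k (upd om k t) =
  noise Fs F t.1 (z k om) (z k.-1 om) (w k.-1 om).
Proof. by rewrite /xi upd_same !z_upd ?w_upd// leq_pred. Qed.

Lemma sum_xi0 k om v : \sum_t iter_weight p t * dot (xi k (upd om k t)) v = 0.
Proof.
under eq_bigr do rewrite xi_upd.
rewrite (sum_iter_weight _ (fun t => dot (noise _ _ t.1 _ _ _) v)) /=.
(* The noise ignores the coin, whose two weights add up to 1. *)
under prod_expect_ext => S do rewrite -mulrDl addrC subrK mul1r.
by apply: batch_mean0 => //; exact: sum_noise_term.
Qed.

Lemma expect_xi_dot0 k (c : V) : E (fun om => dot (xi k om) (z k om - c)) = 0.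
Proof.
apply: (prod_expect_dot0 q_sum1 (i := k)); last exact: sum_xi0.
by move=> om t; rewrite z_upd.
Qed.

Lemma expect_xi_sum_sqnorm :
  E (fun om => enorm (\sum_(k < K) xi k om) ^+ 2) =
  \sum_(k < K) E (fun om => enorm (xi k om) ^+ 2).
Proof.
apply: (martingale_sqnorm q_sum1) => [j k jk om t|]; last exact: sum_xi0.
have jk' := leq_trans (leq_pred j) (ltnW jk).
rewrite /xi !z_upd ?w_upd ?(ltnW jk)//.
by rewrite upd_diff// neq_ltn jk.
Qed.

Lemma expect_xi_sqnorm_le delta k :
  (forall i z1 z2, enorm ((Fs i z1 - F z1) - (Fs i z2 - F z2))
                   <= delta * enorm (z1 - z2)) ->
  E (fun om => enorm (xi k om) ^+ 2) <=
  b%:R^-1 * (2 * delta ^+ 2)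
    * E (fun om => enorm (z k om - w k.-1 om) ^+ 2 + enorm (z k om - z k.-1 om) ^+ 2).
Proof.
move=> lip; rewrite -prod_expectZ; apply: (prod_expect_resample_le q_ge0 q_sum1 (i := k)).
move=> om; under eq_bigr do rewrite xi_upd.
rewrite (sum_iter_weight _ (fun t => enorm (noise _ _ t.1 _ _ _) ^+ 2)) /=.
under prod_expect_ext => S do rewrite -mulrDl addrC subrK mul1r.
rewrite -mulrA; apply: (batch_sqnorm_le n_gt0) => //; first exact: sum_noise_term.
by move=> i; exact: noise_term_sqnorm_le.
Qed.

(** Terms linear in the coins or the noise have mean zero, and squared sums split by orthogonality;
    the negative distances then dominate what is left. *)
Lemma expect_pathwise_le (A eta delta : R) (c : V) :
  (forall i z1 z2, enorm ((Fs i z1 - F z1) - (Fs i z2 - F z2))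
                   <= delta * enorm (z1 - z2)) ->
  p <= 9^-1 -> (eta * delta) ^+ 2 <= p * b%:R / 16 ->
  (forall om, z 0%N om = c) -> (forall om, w 0%N om = c) ->
  E (fun om => A
    + 2^-1 * \sum_(k < K) coin k om
        * (enorm (z k.+1 om - c) ^+ 2 - enorm (w k om - c) ^+ 2)
    + 8^-1 * enorm (\sum_(k < K) coin k om *: (z k.+1 om - w k om)) ^+ 2
    + 8^-1 * enorm (\sum_(k < K) eta *: xi k om) ^+ 2
    - eta * \sum_(k < K) dot (xi k om) (z k om - c)
    + \sum_(k < K) (eta ^+ 2 * enorm (xi k om) ^+ 2
        + enorm (z k om - z k.-1 om) ^+ 2 / 64
        - enorm (z k.+1 om - z k om) ^+ 2 / 8
        - 2 / 5 * p * enorm (z k.+1 om - w k om) ^+ 2)) <= A.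
Proof.
move=> lip p9 step zc wc.
pose X om := \sum_(k < K) enorm (xi k om) ^+ 2.
pose d (k : nat) om := enorm (z k om - z k.-1 om) ^+ 2.
pose a (k : nat) om := enorm (z k om - w k.-1 om) ^+ 2.
pose B om := \sum_(k < K) (64^-1 * d k om - 8^-1 * d k.+1 om
                            - 2 / 5 * p * a k.+1 om).
pose C om := \sum_(k < K) a k.+1 om.
rewrite (@prod_expect_ext _ _ _ _ _ (fun om => A
    + 2^-1 * (\sum_(k < K) coin k om
        * (enorm (z k.+1 om - c) ^+ 2 - enorm (w k om - c) ^+ 2))
    + 8^-1 * enorm (\sum_(k < K) coin k om *: (z k.+1 om - w k om)) ^+ 2
    + 8^-1 * eta ^+ 2 * enorm (\sum_(k < K) xi k om) ^+ 2
    + (- eta) * (\sum_(k < K) dot (xi k om) (z k om - c))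
    + eta ^+ 2 * X om + B om)); last first.
  move=> om; rewrite -scaler_sumr enormZ exprMn real_normK ?num_real//.
  rewrite -[RHS]addrA; congr (_ + _); first by ring.
  rewrite /X /B mulr_sumr -big_split; apply: eq_bigr => k _.
  by rewrite /d /a /=; ring.
rewrite !prod_expectD !prod_expectZ (prod_expect_cst q_sum1).
rewrite prod_expect_sum big1 => [|k _]; last first.
  apply: expect_coin0.
  exact: (coin_free_next k (fun x y => enorm (x - c) ^+ 2 - enorm (y - c) ^+ 2)).
rewrite [X in - eta * X]prod_expect_sum [X in - eta * X]big1 => [|k _]; last first.
  exact: expect_xi_dot0.
rewrite expect_xi_sum_sqnorm -prod_expect_sum -/X.
(* The step size cancels the [1/b] of the batch variance: [p * b / 16 * (2 / b) = p / 8]. *)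
have EX : eta ^+ 2 * E X <= p / 8 * E (fun om => \sum_(k < K) (a k om + d k om)).
  rewrite /X !prod_expect_sum !mulr_sumr; apply: ler_sum => k _.
  have Ek0 : 0 <= E (fun om => a k om + d k om).
    rewrite -[leLHS](prod_expect_cst (I := 'I_K) q_sum1).
    by apply: prod_expect_le => // om; rewrite addr_ge0 ?sqr_ge0.
  apply: le_trans (ler_wpM2l (sqr_ge0 _) (expect_xi_sqnorm_le k lip)) _.
  rewrite mulrA ler_wpM2r//.
  have -> : eta ^+ 2 * (b%:R^-1 * (2 * delta ^+ 2)) =
     (eta * delta) ^+ 2 * (2 * b%:R^-1) by ring.
  have b0 : 0 < b%:R :> R by rewrite ltr0n.
  apply: (le_trans (ler_wpM2r _ step)); first by rewrite mulr_ge0 ?invr_ge0.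
  by rewrite [leLHS](_ : _ = p / 8)//; field; rewrite gt_eqF.
have EC : E (fun om => enorm (\sum_(k < K) coin k om *: (z k.+1 om - w k om)) ^+ 2)
    <= p * E C by exact: expect_coin_sum_sqnorm_le.
(* The noise has weight [1 + 1/8], hence [9/8 * p/8]. After the index shift, [9/64 + 1/8 < 2/5]
   settles [a], and [9/64 * p + 1/64 < 1/8] settles [d]. *)
have EB : 9 / 64 * p * E (fun om => \sum_(k < K) (a k om + d k om))
    + p / 8 * E C + E B <= 0.
  rewrite -!prod_expectZ -!prod_expectD -[leRHS](prod_expect_cst (I := 'I_K) q_sum1).
  apply: prod_expect_le => // om.
  have sd : \sum_(k < K) d k om <= \sum_(k < K) d k.+1 om.
    apply: (@sum_shift_le _ _ (d^~ om)) => [|k]; last exact: sqr_ge0.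
    by rewrite /d /= subrr enorm0 expr0n.
  have sa : \sum_(k < K) a k om <= \sum_(k < K) a k.+1 om.
    apply: (@sum_shift_le _ _ (a^~ om)) => [|k]; last exact: sqr_ge0.
    by rewrite /a /= zc wc subrr enorm0 expr0n.
  rewrite /B /C !big_split/= !sumrN -!mulr_sumr.
  have d0 : 0 <= \sum_(k < K) d k om by apply: sumr_ge0 => k _; exact: sqr_ge0.
  have a0 : 0 <= \sum_(k < K) a k.+1 om by apply: sumr_ge0 => k _; exact: sqr_ge0.
  have h1 := ler_wpM2l p_ge0 sa; have h2 := ler_wpM2r d0 p9.
  have h3 := mulr_ge0 p_ge0 a0.
  lra.
lra.
Qed.

End moments.

(** * Runs of the algorithm *)

Section svogs_run.
Context {R : realType} {dx dy n b K : nat}.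
Local Notation V := 'rV[R]_(dx + dy).
Local Notation Omega := (outcome n b K).
Variables (X : set 'rV[R]_dx) (Y : set 'rV[R]_dy) (f : 'I_n -> V -> R).
Variable i1 : 'I_n.

(** With [G = F - F_1], the first batch average has mean [G z - G wp], which completes [G wp] to
    [G z]; the second has mean [G z - G zp]. Deviations from these means form the noise. *)
Lemma svogs_deltaE (S : 'I_b -> 'I_n) (z zp wp : V) : (0 < b)%N ->
  svogs_delta f i1 1 S z zp wp =
  ((Favg f z - Fc f i1 z)
   + ((Favg f z - Fc f i1 z) - (Favg f zp - Fc f i1 zp)))
  + noise (Fc f) (Favg f) S z zp wp.
Proof.
move=> b_gt0; have b0 : b%:R != 0 :> R by rewrite pnatr_eq0 -lt0n.
have avg (c : V) : b%:R^-1 *: (c *+ b) = c.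
  by rewrite -[c *+ b]scaler_nat scalerA mulVf// scale1r.
rewrite /svogs_delta /noise mul1r -addrA -scalerDr -big_split /=.
rewrite (eq_bigr (fun l => noise_term (Fc f) (Favg f) z zp wp (S l) +
   ((Favg f z - Fc f i1 z - Favg f wp + Fc f i1 wp) +
    (Favg f z - Fc f i1 z - Favg f zp + Fc f i1 zp)))); last first.
  move=> l _; rewrite /noise_term.
  move: (Fc f (S l) z) (Fc f (S l) wp) (Fc f (S l) zp) => a1 a2 a3.
  move: (Favg f z) (Favg f wp) (Favg f zp) => a4 a5 a6.
  move: (Fc f i1 z) (Fc f i1 wp) (Fc f i1 zp) => a7 a8 a9.
  by apply/rowP => j; rewrite !mxE; ring.
rewrite big_split /= sumr_const card_ord scalerDr avg.
move: (_ *: _) (Favg f z) (Favg f wp) (Favg f zp) => x a4 a5 a6.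
move: (Fc f i1 z) (Fc f i1 wp) (Fc f i1 zp) => a7 a8 a9.
by apply/rowP => j; rewrite !mxE; ring.
Qed.

Variables (eta gamma : R) (z0 : V) (eps : 'I_K -> Omega -> R).
Variables (z w : nat -> Omega -> V) (u uhat : 'I_K -> Omega -> V).
Hypothesis run : svogs X Y f i1 eta 1 gamma z0 eps z w u uhat.

(** Induction: the solver's answer depends on the past and the current batch only, and the coin then
    settles [w]. *)
Lemma svogs_past k (om om' : Omega) : (k <= K)%N ->
  (forall j : 'I_K, (j < k)%N -> om j = om' j) ->
  z k om = z k om' /\ w k om = w k om'.
Proof.
elim: k => [|k IHk] kK omk; first by rewrite !(svogs_z0 run) !(svogs_w0 run).
have [_ wk] := IHk (ltnW kK) (fun j jk => omk j (ltnW jk)).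
pose k' := Ordinal kK; have ok : om k' = om' k' by exact: omk.
have zk : z k.+1 om = z k.+1 om'.
  rewrite !(svogs_z run k'); apply: (svogs_adapted run); last by rewrite ok.
  by move=> j jk; apply: omk; exact: ltnW.
by split => //; rewrite !(svogs_w run k') zk wk ok.
Qed.

Lemma svogs_upd (k : 'I_K) (om : Omega) t j : (j <= k)%N ->
  z j (upd om k t) = z j om /\ w j (upd om k t) = w j om.
Proof.
move=> jk; apply: svogs_past; first exact: leq_trans jk (ltnW (ltn_ord k)).
by move=> l lj; rewrite upd_diff// neq_ltn (leq_trans lj jk).
Qed.

Lemma svogs_upd_next (k : 'I_K) (om : Omega) (S : {ffun 'I_b -> 'I_n}) c c' :
  z k.+1 (upd om k (S, c)) = z k.+1 (upd om k (S, c')).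
Proof.
rewrite !(svogs_z run); apply: (svogs_adapted run) => [j jk|].
  by rewrite !upd_diff// neq_ltn jk.
by rewrite !upd_same.
Qed.

Lemma svogs_variational k om zz :
  (0 < b)%N -> 0 < eta -> convex_set (prodset X Y) ->
  differentiable (f i1 : V -> R^o) (uhat k om) -> prodset X Y zz ->
  0 <= dot (eta *: Fc f i1 (uhat k om) + (uhat k om -
    ((1 - gamma) *: z k om + gamma *: w k om
     - eta *: ((Favg f (z k om) - Fc f i1 (z k om))
       + ((Favg f (z k om) - Fc f i1 (z k om))
          - (Favg f (z k.-1 om) - Fc f i1 (z k.-1 om)))
       + xi (Fc f) (Favg f) z w k om)))) (zz - uhat k om).
Proof.
move=> b0 eta0 cvx df Zzz.
have := saddle_variational eta0 cvx df (svogs_exact run k om) Zzz.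
by rewrite /svogs_v svogs_deltaE.
Qed.

(** Computed iterates may leave [prodset X Y], hence [2 * D]. Inductively [|uhat - z_k| <= 2 * D],
    so the solver error is at most [D / 5] and the next iterate stays within [D + D / 5] of the
    set's points. *)
Lemma svogs_iterate_dist D om : 0 <= D ->
  (forall k, eps k om <= 100^-1 * enorm (uhat k om - z k om) ^+ 2) ->
  prodset X Y z0 ->
  (forall z1 z2, prodset X Y z1 -> prodset X Y z2 -> enorm (z1 - z2) <= D) ->
  (forall k : 'I_K, enorm (z k.+1 om - uhat k om) <=
     enorm (uhat k om - z k om) / 10) /\
  (forall k zz, (k <= K)%N -> prodset X Y zz -> enorm (z k om - zz) <= 2 * D).
Proof.
move=> D0 eps_le Zz0 diam.
have close (k : 'I_K) : enorm (z k.+1 om - uhat k om) <=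
    enorm (uhat k om - z k om) / 10.
  rewrite (svogs_z run) -(@ler_pXn2r _ 2)// ?nnegrE ?divr_ge0 ?enorm_ge0//.
  by apply: le_trans (svogs_inexact run k om) (le_trans (eps_le k) _); lra.
split=> //; elim=> [|k IHk] zz kK Zz.
  by rewrite (svogs_z0 run) (le_trans (diam _ _ Zz0 Zz))//; lra.
have Zu : prodset X Y (uhat (Ordinal kK) om).
  by have [] := svogs_exact run (Ordinal kK) om.
have := close (Ordinal kK); have := IHk _ (ltnW kK) Zu => /= h1 h2.
rewrite (le_trans (enormB_trans (uhat (Ordinal kK) om) _ _))//.
have h3 := diam _ _ Zu Zz; rewrite enormBC in h1; lra.
Qed.

End svogs_run.

(** The second branch of the minimum gives [32^-1], the first the bound by [p * b]; [p <= 9^-1]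
    because the square root of [n] is at least 1. *)
Lemma svogs_parameters (R : realType) (n b : nat) (delta p eta : R) :
  (0 < n)%N -> 0 < delta -> b%:Z = Num.ceil (Num.sqrt (n%:R : R)) ->
  p = 1 / (Num.sqrt n%:R + 8) ->
  eta = Num.min (Num.sqrt (p * b%:R) / (4 * delta)) (1 / (32 * delta)) ->
  [/\ (0 < b)%N, 0 < p, p <= 9^-1, 0 < eta
    & eta * delta <= 32^-1 /\ (eta * delta) ^+ 2 <= p * b%:R / 16].
Proof.
move=> n0 d0 bE pE etaE; set r := Num.sqrt n%:R in bE pE.
have r1 : 1 <= r by rewrite -sqrtr1 ler_wsqrtr// ler1n.
have rb : r <= b%:R by rewrite -[b%:R]/(b%:Z%:~R) bE ceil_ge.
have b0 : (0 < b)%N by rewrite -(@ltr0n R) (lt_le_trans _ rb)// (lt_le_trans ltr01).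
have p0 : 0 < p by rewrite pE mul1r invr_gt0; lra.
have p9 : p <= 9^-1 by rewrite pE mul1r lef_pV2 ?posrE; lra.
have pb0 : 0 < p * b%:R by rewrite mulr_gt0 ?ltr0n.
have eta0 : 0 < eta.
  rewrite etaE lt_min; apply/andP; split; apply: divr_gt0;
    by rewrite ?sqrtr_gt0// ?mulr_gt0.
have e1 : eta * delta <= 32^-1.
  rewrite -ler_pdivlMr// etaE ge_min; apply/orP; right.
  by rewrite mul1r invfM.
have e2 : eta * delta <= Num.sqrt (p * b%:R) / 4.
  rewrite -ler_pdivlMr// etaE ge_min; apply/orP; left.
  by rewrite -mulrA invfM.
split => //; split => //; apply: (@le_trans _ _ ((Num.sqrt (p * b%:R) / 4) ^+ 2)).
  rewrite ler_pXn2r// nnegrE ?mulr_ge0// ?sqrtr_ge0//; exact: ltW.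
by rewrite expr_div_n sqr_sqrtr ?(ltW pb0)// (_ : 4 ^+ 2 = 16 :> R)//; ring.
Qed.

(** * The convergence bound *)

Theorem theorem1 (R : realType) (dx dy n : nat) (n_gt0 : (0 < n)%N)
    (X : set 'rV[R]_dx) (Y : set 'rV[R]_dy) (D delta L : R)
    (f : 'I_n -> 'rV[R]_(dx + dy) -> R)
    (Z_neq0 : prodset X Y !=set0)
    (Z_closed : closed (prodset X Y))
    (Z_convex : convex_set (prodset X Y))
    (D_gt0 : 0 < D)
    (Z_diam : forall z1 z2, prodset X Y z1 -> prodset X Y z2 ->
       enorm (z1 - z2) <= D)
    (delta_gt0 : 0 < delta) (delta_leL : delta <= L)
    (f_diff2 : forall i, twice_differentiable (f i))
    (f_smooth : smooth f L)
    (f_cc : forall i, convex_concave (f i))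
    (f_sim : second_order_similarity f delta)
    (zstar : 'rV[R]_(dx + dy)) (zstar_saddle : saddle_point X Y (favg f) zstar)
    (z0 : 'rV[R]_(dx + dy)) (z0_in : prodset X Y z0)
    (e : R) (e_gt0 : 0 < e)
    (K : nat) (K_gt0 : (0 < K)%N)
    (b : nat) (bE : b%:Z = Num.ceil (Num.sqrt (n%:R : R)))
    (gamma p : R) (gammaE : gamma = p) (pE : p = 1 / (Num.sqrt n%:R + 8))
    (eta : R)
    (etaE : eta = Num.min (Num.sqrt (gamma * b%:R) / (4 * delta))
                          (1 / (32 * delta)))
    (alpha : R) (alphaE : alpha = 1)
    (Phi0 : R)
    (Phi0E : Phi0 = 1 / eta * enorm (z0 - zstar) ^+ 2
                    + gamma / (p * eta) * enorm (z0 - zstar) ^+ 2)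
    (zeta : R)
    (zetaE : zeta =
       Num.min
         ((eta ^+ 2 * e ^+ 2) /
          (16 * (9 * eta * L * D
                 + 3 * eta * \big[Num.max/0]_(i < n) enorm (Fc f i z0)
                 + D) ^+ 2))
         ((eta * e) / (4 * (12 * eta ^+ 2 * delta ^+ 2 + 1))))
    (chat : R)
    (chatE : chat = 100 + 2048 * eta ^+ 2 * delta ^+ 2
                    + 64 * Num.sqrt (2 * eta * Phi0))
    (z w : nat -> outcome n b K -> 'rV[R]_(dx + dy))
    (u uhat : 'I_K -> outcome n b K -> 'rV[R]_(dx + dy))
    (run : svogs X Y f (Ordinal n_gt0) eta alpha gamma z0
       (fun k om =>
          Num.min zeta
            (chat^-1 * Num.min (enorm (uhat k om - z k om))
                               (enorm (uhat k om - z k om) ^+ 2)))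
       z w u uhat) :
  expect p (fun om =>
    sup [set K%:R^-1 * \sum_(k < K) dot (Favg f (u k om)) (u k om - zz)
         | zz in prodset X Y])
  <= 10 * D ^+ 2 / (eta * K%:R) + e / 2.
Proof.
(* [gamma = p] is what centres the factors [(chi k)%:R - gamma] of the pathwise bound. *)
subst alpha gamma.
have [b0 p0 p9 eta0 [ed1 ed2]] := svogs_parameters n_gt0 delta_gt0 bE pE etaE.
have p_le1 : p <= 1 by lra.
have L0 : 0 < L := lt_le_trans delta_gt0 delta_leL.
have D0 := ltW D_gt0.
set M := \big[Num.max/0]_(i < n) enorm (Fc f i z0) in zetaE.
have Mi i : enorm (Fc f i z0) <= M by exact: le_bigmax.
have M0 : 0 <= M by exact: le_trans (enorm_ge0 _) (Mi (Ordinal n_gt0)).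
(* Allowance per iteration: [K] of them, divided by [eta * K], give [e / 4]. *)
set tol := eta * e / 4.
have chat100 : 100 <= chat.
  have h1 : 0 <= 2048 * eta ^+ 2 * delta ^+ 2.
    by apply: mulr_ge0; [apply: mulr_ge0; [exact: ler0n|exact: sqr_ge0]|exact: sqr_ge0].
  have h2 : 0 <= 64 * Num.sqrt (2 * eta * Phi0).
    by apply: mulr_ge0; [exact: ler0n|exact: sqrtr_ge0].
  by rewrite chatE -addrA lerDl addr_ge0.
(* The first branch of [zeta] is [(tol / Q) ^+ 2], and [Q] dominates the factor
   [4 * eta * L * D + eta * M + D] required for [tol]. *)
pose Q := 9 * eta * L * D + 3 * eta * M + D.
have Q0 : 0 < Q.
  rewrite /Q ltr_wpDl// addr_ge0// !mulr_ge0 ?ler0n ?(ltW eta0) ?(ltW L0)//.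
have zeta_le : zeta <= (tol / Q) ^+ 2.
  rewrite zetaE ge_min; apply/orP; left.
  rewrite -/Q expr_div_n /tol expr_div_n exprMn (_ : 4 ^+ 2 = 16 :> R).
    by rewrite invfM mulrA.
  by ring.
have chat_le t : 0 <= t -> chat^-1 * t <= 100^-1 * t.
  move=> t0; rewrite ler_wpM2r// lef_pV2 ?posrE//.
    exact: lt_le_trans chat100.
have eps_le (k : 'I_K) om : Num.min zeta (chat^-1 * Num.min (enorm (uhat k om - z k om))
      (enorm (uhat k om - z k om) ^+ 2)) <= 100^-1 * enorm (uhat k om - z k om) ^+ 2.
  rewrite ge_min; apply/orP; right.
  apply: le_trans (chat_le _ (sqr_ge0 _)).
  rewrite ler_wpM2l ?invr_ge0 ?ge_min ?lexx ?orbT//.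
  by rewrite (le_trans _ chat100).
have dist om := svogs_iterate_dist run D0 (eps_le^~ om) z0_in Z_diam.
have small (k : 'I_K) om : enorm (z k.+1 om - uhat k om) * Q <= tol.
  rewrite (svogs_z run) -ler_pdivlMr// -(@ler_pXn2r _ 2)// ?nnegrE ?enorm_ge0//.
    apply: le_trans (svogs_inexact run k om) (le_trans _ zeta_le).
    by rewrite ge_min lexx.
  by rewrite divr_ge0 ?(ltW Q0)// /tol divr_ge0// mulr_ge0 ?ltW.
have Zu (k : 'I_K) om : prodset X Y (uhat k om) by have [] := svogs_exact run k om.
have F_lip z1 z2 := Favg_lipschitz z1 z2 n_gt0 f_smooth.
have sim i z1 z2 := similarity_lipschitz f_diff2 i z1 z2 f_sim.
pose i1 := Ordinal n_gt0.
have G_lip z1 z2 : enorm ((Favg f z1 - Fc f i1 z1) - (Favg f z2 - Fc f i1 z2))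
    <= delta * enorm (z1 - z2).
  move: (sim i1 z1 z2); move: (Favg f z1) (Favg f z2) => x1 x2.
  move: (Fc f i1 z1) (Fc f i1 z2) => y1 y2.
  by rewrite -[x1 - y1]opprB -[x2 - y2]opprB -opprD enormN.
have FM v : prodset X Y v -> enorm (Favg f v) <= M + L * D.
  move=> Zv; rewrite -[Favg f v](subrK (Favg f z0)).
  rewrite (le_trans (enormD _ _))// addrC lerD ?enorm_Favg_le//.
  by rewrite (le_trans (F_lip _ _))// ler_wpM2l ?(ltW L0)// Z_diam.
(* [Psi] does not mention the comparison point, so on each path it bounds the supremum as well. *)
pose Psi om := K%:R * tol + 21 / 4 * D ^+ 2
    + 2^-1 * \sum_(k < K) coin p k om
        * (enorm (z k.+1 om - z0) ^+ 2 - enorm (w k om - z0) ^+ 2)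
    + 8^-1 * enorm (\sum_(k < K) coin p k om *: (z k.+1 om - w k om)) ^+ 2
    + 8^-1 * enorm (\sum_(k < K) eta *: xi (Fc f) (Favg f) z w k om) ^+ 2
    - eta * \sum_(k < K) dot (xi (Fc f) (Favg f) z w k om) (z k om - z0)
    + \sum_(k < K) (eta ^+ 2 * enorm (xi (Fc f) (Favg f) z w k om) ^+ 2
        + enorm (z k om - z k.-1 om) ^+ 2 / 64
        - enorm (z k.+1 om - z k om) ^+ 2 / 8
        - 2 / 5 * p * enorm (z k.+1 om - w k om) ^+ 2).
have path om zz : prodset X Y zz ->
    eta * \sum_(k < K) dot (Favg f (z k.+1 om)) (z k.+1 om - zz) <= Psi om.
  move=> Zzz; have [close far] := dist om.
  apply: (pathwise_bound F_lip G_lip (ltW delta_gt0) delta_leL (ltW eta0) ed1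
    (ltW p0) p9 (Z := z^~ om) (W := w^~ om) (UH := uhat^~ om)
    (XI := fun k => xi (Fc f) (Favg f) z w k om) (chi := fun k => (om k).2)
    (D := D) (M := M)) => //.
  - exact: svogs_z0 run om.
  - exact: svogs_w0 run om.
  - by move=> k; rewrite (svogs_w run).
  - move=> k; apply: (svogs_variational run) => //; exact: (f_diff2 i1).1.
  - by move=> k; exact: Z_diam.
  - by move=> k; exact: FM.
  - move=> k; rewrite (le_trans (close k))// ler_pdivrMr// enormBC.
    rewrite (le_trans (far k _ (ltnW (ltn_ord k)) (Zu k om)))//; lra.
  - move=> k; apply: le_trans (small k om); rewrite ler_wpM2l ?enorm_ge0//.
    have h1 : 0 <= eta * L * D by rewrite !mulr_ge0// ltW.
    have h2 : 0 <= eta * M by rewrite mulr_ge0// ltW.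
    by rewrite /Q; lra.
  - exact: Z_diam.
  - by move=> k kK; exact: far.
have K0 : 0 < K%:R :> R by rewrite ltr0n.
have EPsi : expect p Psi <= K%:R * tol + 21 / 4 * D ^+ 2.
  apply: (expect_pathwise_le n_gt0 b0 (ltW p0) p_le1 _ _ _ _ _ sim p9 ed2
    (svogs_z0 run) (svogs_w0 run)) => //.
  - by move=> k om t j jk; have [] := svogs_upd run om t jk.
  - by move=> k om t j jk; have [] := svogs_upd run om t jk.
  - exact: svogs_upd_next run.
apply: (@le_trans _ _ (expect p (fun om => (eta * K%:R)^-1 * Psi om))).
  apply: (@prod_expect_le _ _ _ (iter_weight p)) => [t|om].
    by apply: iter_weight_ge0 => //; exact: ltW.
  apply: ge_sup; first by have [v Zv] := Z_neq0; eexists; exists v.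
  move=> _ [zz Zzz <-]; have := path om zz Zzz.
  under eq_bigr do rewrite (svogs_z run).
  set S := \sum_(k < K) _ => S_le.
  have -> : K%:R^-1 * S = (eta * K%:R)^-1 * (eta * S).
    by field; rewrite !gt_eqF.
  by rewrite ler_wpM2l// invr_ge0 mulr_ge0// ltW.
rewrite [leLHS](@prod_expectZ _ _ _ (iter_weight p)).
apply: (@le_trans _ _ ((eta * K%:R)^-1 * (K%:R * tol + 21 / 4 * D ^+ 2))).
  by rewrite ler_wpM2l// invr_ge0 mulr_ge0// ltW.
(* Slack remains in both terms: [1/4 <= 1/2] and [21/4 <= 10]. *)
have -> : (eta * K%:R)^-1 * (K%:R * tol + 21 / 4 * D ^+ 2) =
    e / 4 + 21 / 4 * (D ^+ 2 / (eta * K%:R)).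
  by rewrite /tol; field; rewrite !gt_eqF.
have : 0 <= D ^+ 2 / (eta * K%:R) by rewrite divr_ge0 ?sqr_ge0// mulr_ge0// ltW.
rewrite -[10 * _ / _]mulrA; lra.
Qed.
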